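(* Assume there is $\rho>0$ with $\min_{1\le i\le n}\pi_{f_0}(x_i)\ge\rho$ and $\min_{1\le i\le n}[1-\pi_{f_0}(x_i)]\ge\rho$. Let $m_f$ be a partition of $\{1,\dots,n\}$ into intervals with $|J|\ge\Gamma\log^2(n)$ for all $J\in m_f$, where $\Gamma>0$ is a constant, and let $\mathcal{M}$ be a collection of partitions of $\{1,\dots,n\}$ into intervals such that $m_f$ refines every $m\in\mathcal{M}$ (every element of $m$ is a union of elements of $m_f$). For $m\in\mathcal{M}$ let $S_m$ be the span of $\{\mathbb{1}_J,J\in m\}$, $D_m=|m|$, $\hat f_m=\arg\min_{f\in S_m}\gamma_n(f)$ and $f_m=\arg\min_{f\in S_m}\mathcal{K}(\mathbb{P}_{f_0}^{(n)},\mathbb{P}_f^{(n)})$. Let $(L_m)_{m\in\mathcal{M}}$ be positive weights with $\Sigma=\sum_{m\in\mathcal{M}}\exp(-L_mD_m)<+\infty$. Let $\mu>1$ and $\mathrm{pen}:\mathcal{M}\to\mathbb{R}_+$ satisfy, for all $m\in\mathcal{M}$, $$\mathrm{pen}(m)\ge\mu\frac{D_m}{n}\big(1+6L_m+8\sqrt{L_m}\big).$$ Let $\hat m=\arg\min_{m\in\mathcal{M}}\{\gamma_n(\hat f_m)+\mathrm{pen}(m)\}$ and $\tilde f=\hat f_{\hat m}$. Then, with $C_\mu=2\mu^{1/3}/(\mu^{1/3}-1)$, $$\mathbb{E}_{f_0}\big[h^2(\mathbb{P}^{(n)}_{f_0},\mathbb{P}^{(n)}_{\tilde f})\big]\le C_\mu\inf_{m\in\mathcal{M}}\big\{\mathcal{K}(\mathbb{P}_{f_0}^{(n)},\mathbb{P}_{f_m}^{(n)})+\mathrm{pen}(m)\big\}+\frac{C(\rho,\mu,\Gamma,\Sigma)}{n},$$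 where $C(\rho,\mu,\Gamma,\Sigma)$ is a constant depending only on $\rho,\mu,\Gamma,\Sigma$.
   Context: Logistic regression model: $Y_1,\dots,Y_n\in\{0,1\}$ independent with $\mathbb{E}_{f_0}(Y_i)=\pi_{f_0}(x_i)$, where $\pi_f(x)=e^{f(x)}/(1+e^{f(x)})$; the design is identified with $\{1,\dots,n\}$ (functions are maps $\{1,\dots,n\}\to\mathbb{R}$). $\mathbb{P}^{(n)}_f$ is the law of $(Y_1,\dots,Y_n)$ when the $Y_i$ are independent Bernoulli$(\pi_f(x_i))$. $\gamma_n(f)=\frac1n\sum_{i=1}^n\{\log(1+e^{f(x_i)})-Y_if(x_i)\}$; $\mathcal{K}(\mathbb{P}_{f_0}^{(n)},\mathbb{P}_{f}^{(n)})=\frac1n\sum_{i=1}^n\big[\pi_{f_0}(x_i)\log\frac{\pi_{f_0}(x_i)}{\pi_f(x_i)}+(1-\pi_{f_0}(x_i))\log\frac{1-\pi_{f_0}(x_i)}{1-\pi_f(x_i)}\big]$; the normalized squared Hellinger distance is $h^2(\mathbb{P}_{f_0}^{(n)},\mathbb{P}_{g}^{(n)})=\frac1{2n}\sum_{i=1}^n\big[(\sqrt{\pi_{f_0}(x_i)}-\sqrt{\pi_g(x_i)})^2+(\sqrt{1-\pi_{f_0}(x_i)}-\sqrt{1-\pi_g(x_i)})^2\big]$. $|J|$ is the number of points in the interval $J$.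
   Formalization: When Y is constant on a block of m the argmin f̂_m does not exist in S_m; here γ_n(f̂_m) is read as the infimum of γ_n over S_m and π_{f̂_m} as the limit of π_f along a minimizing sequence in S_m, which agrees with the argmin whenever it exists. *)

(* Defs.v *)
From mathcomp Require Import all_boot all_order all_algebra.
From mathcomp Require Import all_classical all_reals all_analysis.
Set Implicit Arguments. Unset Strict Implicit. Unset Printing Implicit Defensive.
Import Order.TTheory GRing.Theory Num.Theory numFieldNormedType.Exports.
Local Open Scope ring_scope.
Local Open Scope classical_set_scope.

Section Logistic.
Variables (R : realType) (n : nat).

(* design identified with 'I_n (points x_1..x_n = indices 0..n-1) *)
Definition pi_ (f : 'I_n -> R) (i : 'I_n) : R := expR (f i) / (1 + expR (f i)).

Definition bit (b : bool) : R := if b then 1 else 0.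

Definition gamma_n (Y : {ffun 'I_n -> bool}) (f : 'I_n -> R) : R :=
  n%:R^-1 * \sum_(i < n) (ln (1 + expR (f i)) - bit (Y i) * f i).

Definition KL (f0 f : 'I_n -> R) : R :=
  n%:R^-1 * \sum_(i < n)
    (pi_ f0 i * ln (pi_ f0 i / pi_ f i)
     + (1 - pi_ f0 i) * ln ((1 - pi_ f0 i) / (1 - pi_ f i))).

(* normalized squared Hellinger distance between the product Bernoulli laws
   with success-probability vectors p and q *)
Definition hell2 (p q : 'I_n -> R) : R :=
  (2 * n%:R)^-1 * \sum_(i < n)
    ((Num.sqrt (p i) - Num.sqrt (q i)) ^+ 2
     + (Num.sqrt (1 - p i) - Num.sqrt (1 - q i)) ^+ 2).

Definition prob (f0 : 'I_n -> R) (Y : {ffun 'I_n -> bool}) : R :=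
  \prod_(i < n) (if Y i then pi_ f0 i else 1 - pi_ f0 i).

Definition Expect (f0 : 'I_n -> R) (Z : {ffun 'I_n -> bool} -> R) : R :=
  \sum_(Y : {ffun 'I_n -> bool}) prob f0 Y * Z Y.

Definition is_interval (J : {set 'I_n}) : Prop :=
  forall i j k : 'I_n, i \in J -> k \in J -> (i <= j)%N -> (j <= k)%N -> j \in J.

Definition interval_partition (m : {set {set 'I_n}}) : Prop :=
  finset.partition m [set: 'I_n] /\ (forall J, J \in m -> is_interval J).

Definition refines (mf m : {set {set 'I_n}}) : Prop :=
  forall J, J \in m -> exists A : {set {set 'I_n}}, A \subset mf /\ J = finset.cover A.

Definition S_ (m : {set {set 'I_n}}) : set ('I_n -> R) :=
  [set f | exists c : {set 'I_n} -> R,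
     f = (fun i => \sum_(J in m) c J * (if i \in J then 1 else 0))].

(* (g, q) describes the minimum contrast estimator hat f_m on the sample Y,
   taken in the closure of S_m (the infimum of gamma_n over S_m need not be
   attained): g = gamma_n(hat f_m) is the infimum of gamma_n over S_m, and
   q = pi_{hat f_m} is the limit of pi_{f_k} along a minimizing sequence
   (f_k) in S_m. *)
Definition is_mce (m : {set {set 'I_n}}) (Y : {ffun 'I_n -> bool})
    (g : R) (q : 'I_n -> R) : Prop :=
  (forall f, S_ m f -> g <= gamma_n Y f) /\
  exists fk : nat -> 'I_n -> R,
    (forall k, S_ m (fk k)) /\
    (fun k => gamma_n Y (fk k)) @ \oo --> g /\
    (forall i, (fun k => pi_ (fk k) i) @ \oo --> q i).

End Logistic.

(* Main.v *)
(** On a partition m every estimator is explicit: hat f_m has success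
probability q_J = (block average of Y) and the Kullback projection of f_0 has
r_J = (block average of p = pi_{f_0}).  Hence
gamma_n(hat f_m) = gamma_n(logit r) - K(q, r), and the selection inequality
reads, with A = log-likelihood ratio of r against p plus 2 n h^2(p, r),
  2 h^2(p, r) <= gamma_n(logit r_m) - gamma_n(f_0) + pen(m)
                 + (A + n K(q, r)) / n - pen(hat m)
at r = r_{hat m}.  The triangle inequality for h and h^2 <= K / 2 transfer
this to h^2(p, q).  Two exponential moments finish the proof by a union bound
over the models: E exp(A / 2) <= 1 (Hellinger affinity), and moments of
n K(q, r), a sum of independent terms |J| kl(q_J, r_J).  By Chernoff each side
of such a term has tail at most exp(-t), so E exp(|J| kl / 2) <= 3 whatever p
is; and kl is at most 0.7 times the chi-square statistic, up to an event
negligible for large |J|, so that the mean stays below the budget 1 per block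
left by the penalty.  The size of the blocks serves only there: they are large
once n is, and small n is covered by h^2 <= 1. *)

Require Import Defs.
From mathcomp Require Import all_boot all_order all_algebra.
From mathcomp Require Import all_classical all_reals all_analysis.
From mathcomp Require Import ring lra.
Import Order.TTheory GRing.Theory Num.Theory numFieldNormedType.Exports.
Local Open Scope ring_scope.
Local Open Scope classical_set_scope.

(** * Divergences between Bernoulli laws and scalar inequalities *)

Definition kl {R : realType} (q p : R) : R :=
  q * ln (q / p) + (1 - q) * ln ((1 - q) / (1 - p)).

(** Twice the squared Hellinger distance of two Bernoulli laws, so [hell2] averages [hd / 2] over
    the design. *)
Definition hd {R : realType} (p q : R) : R :=
  (Num.sqrt p - Num.sqrt q) ^+ 2 + (Num.sqrt (1 - p) - Num.sqrt (1 - q)) ^+ 2.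

(** The negative of the Bernoulli entropy: the part of [kl] and of the contrast that does not depend
    on the fitted function. *)
Definition ent {R : realType} (q : R) : R := q * ln q + (1 - q) * ln (1 - q).

Lemma ln_le_subr1 {R : realType} (x : R) : 0 < x -> ln x <= x - 1.
Proof. by move=> x0; have := @le_ln1Dx R (x - 1); rewrite [1 + _]addrC subrK; apply; lra. Qed.

Lemma ln_le_sqrt {R : realType} (x : R) : 0 < x -> ln x <= 2 * (Num.sqrt x - 1).
Proof.
move=> x0; have s0 : 0 < Num.sqrt x by rewrite sqrtr_gt0.
rewrite -{1}(sqr_sqrtr (ltW x0)) expr2 lnM ?posrE //.
by have := ln_le_subr1 _ s0; lra.
Qed.

(** This is ln x <= 2 (sqrt x - 1) at x = p / q. Added over the two outcomes, the lower bounds give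
    2 minus twice the affinity, that is [hd]. *)
Lemma mul_ln_div_ge {R : realType} (q p : R) : 0 <= q -> 0 < p ->
  2 * (q - Num.sqrt p * Num.sqrt q) <= q * ln (q / p).
Proof.
rewrite le_eqVlt => /predU1P[<-|q0] p0; first by rewrite sqrtr0; lra.
have sq0 : 0 < Num.sqrt q by rewrite sqrtr_gt0.
have := @ln_le_sqrt R (p / q) (divr_gt0 p0 q0).
have -> : ln (p / q) = - ln (q / p).
  by rewrite !ln_div ?posrE //; lra.
have -> : Num.sqrt (p / q) = Num.sqrt p * Num.sqrt q / q.
  rewrite sqrtrM ?ltW // sqrtrV ?ltW //.
  rewrite -[X in _ = _ / X](sqr_sqrtr (ltW q0)).
  by field; rewrite gt_eqF.
move=> h; have : q * - ln (q / p) <= q * (2 * (Num.sqrt p * Num.sqrt q / q - 1)).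
  by rewrite ler_pM2l.
have -> : q * (2 * (Num.sqrt p * Num.sqrt q / q - 1)) = 2 * (Num.sqrt p * Num.sqrt q - q).
  by field; rewrite gt_eqF.
by lra.
Qed.

Lemma hdE {R : realType} (p q : R) : 0 <= p <= 1 -> 0 <= q <= 1 ->
  hd p q = 2 - 2 * (Num.sqrt p * Num.sqrt q + Num.sqrt (1 - p) * Num.sqrt (1 - q)).
Proof.
move=> /andP[p0 p1] /andP[q0 q1].
rewrite /hd; have := sqr_sqrtr p0; have := sqr_sqrtr q0.
have := @sqr_sqrtr _ (1 - p); have := @sqr_sqrtr _ (1 - q).
rewrite !subr_ge0 => /(_ q1) + /(_ p1); lra.
Qed.

Lemma hdC {R : realType} (p q : R) : hd p q = hd q p.
Proof. by rewrite /hd; ring. Qed.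

Lemma hd_ge0 {R : realType} (p q : R) : 0 <= hd p q.
Proof. by rewrite addr_ge0 // sqr_ge0. Qed.

Lemma hd_le2 {R : realType} (p q : R) : 0 <= p <= 1 -> 0 <= q <= 1 -> hd p q <= 2.
Proof.
move=> p01 q01; rewrite hdE //.
have := mulr_ge0 (sqrtr_ge0 p) (sqrtr_ge0 q).
have := mulr_ge0 (sqrtr_ge0 (1 - p)) (sqrtr_ge0 (1 - q)); lra.
Qed.

Lemma kl_ge_hd {R : realType} (q p : R) : 0 <= q <= 1 -> 0 < p < 1 -> hd p q <= kl q p.
Proof.
move=> /andP[q0 q1] /andP[p0 p1]; rewrite hdE ?q0 ?q1 ?(ltW p0) ?(ltW p1) //.
have := mul_ln_div_ge q p q0 p0.
have : 2 * ((1 - q) - Num.sqrt (1 - p) * Num.sqrt (1 - q)) <= (1 - q) * ln ((1 - q) / (1 - p)).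
  by apply: mul_ln_div_ge; lra.
rewrite /kl; lra.
Qed.

Lemma kl_ge0 {R : realType} (q p : R) : 0 <= q <= 1 -> 0 < p < 1 -> 0 <= kl q p.
Proof. by move=> q01 p01; rewrite (le_trans (hd_ge0 p q)) // kl_ge_hd. Qed.

Lemma ln_le_sqrt_sqrt {R : realType} (x : R) : 0 < x ->
  ln x <= 4 * (Num.sqrt (Num.sqrt x) - 1).
Proof.
move=> x0; have s0 : 0 < Num.sqrt x by rewrite sqrtr_gt0.
rewrite -{1}(sqr_sqrtr (ltW x0)) expr2 lnM ?posrE //.
by have := ln_le_sqrt _ s0; lra.
Qed.

(** With s = (q / p)^(1/4), bounding ln (q / p) by 4 (s - 1) turns the claim into a polynomial
    inequality in s. Near s = 1 this bound would allow the constant 5/8, which leaves room below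
    7/10. *)
Lemma mul_ln_div_le {R : realType} (q p : R) : 0 < p -> 7 / 10 * p <= q ->
  q * ln (q / p) <= q - p + 7 / 10 * ((q - p) ^+ 2 / p).
Proof.
move=> p0 qp; have q0 : 0 < q by lra.
have t0 : 0 < q / p by rewrite divr_gt0.
have := ln_le_sqrt_sqrt _ t0; set s := Num.sqrt (Num.sqrt (q / p)) => h.
have s0 : 0 <= s by rewrite sqrtr_ge0.
have s4 : s ^+ 4 = q / p.
  by rewrite (exprM s 2 2) sqr_sqrtr ?sqrtr_ge0 // sqr_sqrtr // ltW.
have sge : 9 / 10 <= s.
  rewrite -(@ler_pXn2r _ 4) ?nnegrE //.
  by rewrite s4 ler_pdivlMr //; lra.
have qE : q = s ^+ 4 * p by rewrite s4 divfK // gt_eqF.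
have -> : q - p + 7 / 10 * ((q - p) ^+ 2 / p) =
    p * (s ^+ 4 - 1 + 7 / 10 * (s ^+ 4 - 1) ^+ 2).
  by rewrite qE; field; rewrite gt_eqF.
apply: (@le_trans _ _ (q * (4 * (s - 1)))); first by rewrite ler_pM2l.
have -> : q * (4 * (s - 1)) = p * (s ^+ 4 * (4 * (s - 1))) by rewrite [in LHS]qE; ring.
rewrite ler_pM2l //; clear h qE s4.
(* The difference of the two sides is (s - 1)^2 times a cofactor which, written in t = s - 9/10, has
   nonnegative coefficients. The bound 9/10 is available since (9/10)^4 <= 7/10. *)
have [t t_ge0 ->] : exists2 t, 0 <= t & s = t + 9 / 10 by exists (s - 9 / 10); lra.
have : 0 <= (t - 1 / 10) ^+ 2 * (7 / 10 * ((t + 19 / 10) ^+ 2 * ((t + 9 / 10) ^+ 2 + 1) ^+ 2)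
    - (4 * (t + 9 / 10) ^+ 3 + 3 * (t + 9 / 10) ^+ 2 + 2 * (t + 9 / 10) + 1)).
  rewrite mulr_ge0 ?sqr_ge0 //.
  have t2 := exprn_ge0 2 t_ge0; have t3 := exprn_ge0 3 t_ge0; have t4 := exprn_ge0 4 t_ge0.
  by have t5 := exprn_ge0 5 t_ge0; have t6 := exprn_ge0 6 t_ge0; lra.
by lra.
Qed.

Lemma kl_le_chi2 {R : realType} (q p : R) : 0 < p < 1 ->
  7 / 10 * p <= q -> 7 / 10 * (1 - p) <= 1 - q ->
  kl q p <= 7 / 10 * ((q - p) ^+ 2 / (p * (1 - p))).
Proof.
move=> /andP[p0 p1] h1 h2; have p1' : 0 < 1 - p by lra.
have := mul_ln_div_le q p p0 h1; have := mul_ln_div_le (1 - q) (1 - p) p1' h2.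
have -> : (q - p) ^+ 2 / (p * (1 - p)) = (q - p) ^+ 2 / p + (1 - q - (1 - p)) ^+ 2 / (1 - p).
  by field; rewrite !gt_eqF.
rewrite /kl.
move: (q * ln _) ((1 - q) * ln _) ((q - p) ^+ 2 / p) ((1 - q - (1 - p)) ^+ 2 / (1 - p)) => a b c d.
by lra.
Qed.

Lemma expR_le_quad {R : realType} (u : R) : 0 <= u ->
  expR u <= 1 + u + 3 / 4 * u ^+ 2 * expR u.
Proof.
move=> u0.
have sub1 (x : R) : expR x - 1 <= x * expR x.
  have h : (1 - x) * expR x <= expR (- x) * expR x by rewrite ler_wpM2r ?expR_ge0 ?expR_ge1Dx.
  by rewrite -expRD addNr expR0 in h; lra.
pose e := expR (u / 2).
have eE : expR u = e * e by rewrite /e -expRD; congr expR; lra.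
have h1 := sub1 (u / 2); have h2 := sub1 u.
rewrite -/e eE in h1 h2 *.
have e1 : 1 <= e by have := expR_ge1Dx (u / 2); rewrite -/e; lra.
have h3 : e * e - 1 <= u / 2 * e * (e + 1).
  have -> : e * e - 1 = (e - 1) * (e + 1) by ring.
  by rewrite ler_wpM2r //; lra.
have h4 : u * (e - 1) <= u * (u / 2 * (e * e)).
  by rewrite ler_wpM2l //; nra.
have h5 : u * (e * e - 1) <= u * (u * (e * e)) by rewrite ler_wpM2l.
by lra.
Qed.

(** Interpolates exp (z / 52) between its tangent at 0 and exp (z / 2), so that a bound on the mean
    and one on the moment of order 1/2 control the moment of order 1/52. With u = z / 52, the
    remainder 3/4 u^2 e^u is absorbed by e^(26 u) - 1 >= e^u (25 u)^2 / 2, and (3/4) / (625/2) =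
    12/5000. *)
Lemma expR_interp {R : realType} (z : R) : 0 <= z ->
  expR (z / 52) <= 1 + z / 52 + 12 / 5000 * (expR (z / 2) - 1).
Proof.
move=> z0; have u0 : 0 <= z / 52 by lra.
have h := expR_le_quad _ u0.
have e1 : 1 <= expR (z / 52) by have := expR_ge1Dx (z / 52); lra.
have : expR (z / 2) = expR (z / 52) * expR (25 * (z / 52)) by rewrite -expRD; congr expR; lra.
have h25 : 1 + (25 * (z / 52)) ^+ 2 / 2 <= expR (25 * (z / 52)).
  by apply: (@expR_ge1Dxn _ _ 1); lra.
move: (expR (25 * _)) (expR (z / 2)) h25 => E F h25 EF.
have : expR (z / 52) * (1 + (25 * (z / 52)) ^+ 2 / 2) <= F by rewrite EF ler_wpM2l // expR_ge0.
move: (expR (z / 52)) e1 h => e; move: (z / 52) u0 => u u0 e1 h hF.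
have : 0 <= u ^+ 2 * e by rewrite mulr_ge0 ?sqr_ge0 //; lra.
by lra.
Qed.

Lemma sqr_sub_sqrt {R : realType} (p q : R) : 0 <= p <= 1 -> 0 <= q <= 1 ->
  (p - q) ^+ 2 <= 4 * (Num.sqrt p - Num.sqrt q) ^+ 2.
Proof.
move=> /andP[p0 p1] /andP[q0 q1].
have a0 := sqrtr_ge0 p; have b0 := sqrtr_ge0 q.
have a1 : Num.sqrt p <= 1 by rewrite -sqrtr1 ler_sqrt.
have b1 : Num.sqrt q <= 1 by rewrite -sqrtr1 ler_sqrt.
rewrite -{1}(sqr_sqrtr p0) -{1}(sqr_sqrtr q0) subr_sqr exprMn mulrC.
rewrite ler_wpM2r ?sqr_ge0 //; nra.
Qed.

Lemma hd_ge_sqr {R : realType} (p q : R) : 0 <= p <= 1 -> 0 <= q <= 1 ->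
  (p - q) ^+ 2 / 2 <= hd p q.
Proof.
move=> p01 q01; have h1 := sqr_sub_sqrt p q p01 q01.
have h2 : (p - q) ^+ 2 <= 4 * (Num.sqrt (1 - p) - Num.sqrt (1 - q)) ^+ 2.
  have -> : p - q = - (1 - p - (1 - q)) by ring.
  by rewrite sqrrN; apply: sqr_sub_sqrt; lra.
rewrite /hd; lra.
Qed.

(** [hd] is a squared Euclidean distance, and (u + v)^2 <= a u^2 + b v^2 for conjugate a and b:
    multiplied by a - 1, the defect is the square of (a - 1) u - v, because a b = a + b. *)
Lemma hd_triangle {R : realType} (a b x y z : R) :
  0 < a -> 0 < b -> a^-1 + b^-1 = 1 ->
  hd x z <= a * hd x y + b * hd y z.
Proof.
move=> a0 b0 ab.
have sq (u v : R) : (u + v) ^+ 2 <= a * u ^+ 2 + b * v ^+ 2.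
  have abE : a * b = a + b.
    by rewrite -[LHS]mulr1 -ab; field; rewrite !gt_eqF.
  have a1 : 1 < a by nra.
  have : 0 <= (a - 1) * u ^+ 2 - 2 * u * v + (b - 1) * v ^+ 2.
    rewrite -(pmulr_rge0 _ (_ : 0 < a - 1)); last by lra.
    have -> : (a - 1) * ((a - 1) * u ^+ 2 - 2 * u * v + (b - 1) * v ^+ 2)
       = ((a - 1) * u - v) ^+ 2 + (a * b - (a + b)) * v ^+ 2 by ring.
    by rewrite abE subrr mul0r addr0 sqr_ge0.
  by lra.
rewrite /hd.
have := sq (Num.sqrt x - Num.sqrt y) (Num.sqrt y - Num.sqrt z).
have := sq (Num.sqrt (1 - x) - Num.sqrt (1 - y)) (Num.sqrt (1 - y) - Num.sqrt (1 - z)).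
rewrite !addrA !subrK; lra.
Qed.

Lemma klE {R : realType} (q p : R) : 0 <= q <= 1 -> 0 < p < 1 ->
  kl q p = ent q - q * ln p - (1 - q) * ln (1 - p).
Proof.
move=> /andP[q0 q1] /andP[p0 p1].
have aux (a b : R) : 0 <= a -> 0 < b -> a * ln (a / b) = a * ln a - a * ln b.
  rewrite le_eqVlt => /predU1P[<-|a0] b0; first by rewrite !mul0r subrr.
  by rewrite ln_div ?posrE // mulrBr.
by rewrite /kl /ent !aux ?subr_ge0 ?subr_gt0 //; ring.
Qed.

(** Mixing q with a fair coin moves it inside (0, 1), where a logit exists, while the likelihood
    ratio of q to the mixture stays below 1 / (1 - e). This provides near minimizers of the contrast
    when a block average of Y is 0 or 1. *)
Lemma kl_mix_le {R : realType} (q e : R) : 0 <= q <= 1 -> 0 < e < 1 ->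
  kl q ((1 - e) * q + e / 2) <= - ln (1 - e).
Proof.
move=> /andP[q0 q1] /andP[e0 e1].
have aux (a b : R) : 0 <= a -> 0 < b -> (1 - e) * a <= b ->
    a * ln (a / b) <= a * - ln (1 - e).
  rewrite le_eqVlt => /predU1P[<-|a0] b0 h; first by rewrite !mul0r.
  rewrite ler_pM2l // -lnV ?posrE ?subr_gt0 // ler_ln ?posrE ?invr_gt0 ?subr_gt0 ?divr_gt0 //.
  by rewrite ler_pdivrMr // mulrC ler_pdivlMr ?subr_gt0 // mulrC.
have h1 := aux q ((1 - e) * q + e / 2) q0.
have h2 := aux (1 - q) (1 - ((1 - e) * q + e / 2)).
have {}h1 : q * ln (q / ((1 - e) * q + e / 2)) <= q * - ln (1 - e) by apply: h1; nra.
have {}h2 : (1 - q) * ln ((1 - q) / (1 - ((1 - e) * q + e / 2))) <= (1 - q) * - ln (1 - e).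
  by apply: h2; nra.
rewrite /kl; lra.
Qed.

(** * Expectation under independent Bernoulli coordinates *)

Definition bweight {R : realType} {I : finType} (p : I -> R) (Y : {ffun I -> bool}) : R :=
  \prod_i (if Y i then p i else 1 - p i).

(** At [p = pi_ f0] this is [Expect f0] by unfolding. *)
Definition bex {R : realType} {I : finType} (p : I -> R) (Z : {ffun I -> bool} -> R) : R :=
  \sum_Y bweight p Y * Z Y.

Lemma bex_prod {R : realType} {I : finType} (p : I -> R) (g : I -> bool -> R) :
  bex p (fun Y => \prod_i g i (Y i)) = \prod_i (p i * g i true + (1 - p i) * g i false).
Proof.
have -> : bex p (fun Y => \prod_i g i (Y i)) =
    \sum_(Y : {ffun I -> bool}) \prod_i ((if Y i then p i else 1 - p i) * g i (Y i)).
  by apply: eq_bigr => Y _; rewrite big_split.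
rewrite -(bigA_distr_bigA (fun i b => (if b then p i else 1 - p i) * g i b)) /=.
by apply: eq_bigr => i _; rewrite big_bool.
Qed.

Lemma bweight_ge0 {R : realType} {I : finType} (p : I -> R) Y :
  (forall i, 0 <= p i <= 1) -> 0 <= bweight p Y.
Proof.
by move=> p01; apply: prodr_ge0 => i _; have := p01 i; case: (Y i); lra.
Qed.

Lemma bweight_sum {R : realType} {I : finType} (p : I -> R) : \sum_Y bweight p Y = 1.
Proof.
have -> : \sum_Y bweight p Y = bex p (fun Y => \prod_(i : I) (fun _ _ => 1) i (Y i)).
  by apply: eq_bigr => Y _; rewrite big1 // mulr1.
by rewrite (bex_prod p (fun _ _ => 1)) big1 // => i _; ring.
Qed.

Lemma bex_cst {R : realType} {I : finType} (p : I -> R) c : bex p (fun _ => c) = c.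
Proof. by rewrite /bex -mulr_suml bweight_sum mul1r. Qed.

Lemma bexD {R : realType} {I : finType} (p : I -> R) Z1 Z2 :
  bex p (fun Y => Z1 Y + Z2 Y) = bex p Z1 + bex p Z2.
Proof. by rewrite /bex -(@big_split R 0 +%R); apply: eq_bigr => Y _; rewrite mulrDr. Qed.

Lemma bexZ {R : realType} {I : finType} (p : I -> R) c Z :
  bex p (fun Y => c * Z Y) = c * bex p Z.
Proof. by rewrite /bex mulr_sumr; apply: eq_bigr => Y _; rewrite mulrCA. Qed.

Lemma bex_sum {R : realType} {I J : finType} (p : I -> R) (P : pred J) (Z : J -> _ -> R) :
  bex p (fun Y => \sum_(j | P j) Z j Y) = \sum_(j | P j) bex p (Z j).
Proof.
by rewrite /bex exchange_big /=; apply: eq_bigr => Y _; rewrite mulr_sumr.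
Qed.

Lemma bex_le {R : realType} {I : finType} (p : I -> R) Z1 Z2 :
  (forall i, 0 <= p i <= 1) -> (forall Y, Z1 Y <= Z2 Y) -> bex p Z1 <= bex p Z2.
Proof. by move=> p01 h; apply: ler_sum => Y _; rewrite ler_wpM2l // bweight_ge0. Qed.

Lemma eq_bex {R : realType} {I : finType} (p : I -> R) Z1 Z2 :
  Z1 =1 Z2 -> bex p Z1 = bex p Z2.
Proof. by move=> h; apply: eq_bigr => Y _; rewrite h. Qed.

Lemma bex_coord {R : realType} {I : finType} (p : I -> R) i (g : bool -> R) :
  bex p (fun Y => g (Y i)) = p i * g true + (1 - p i) * g false.
Proof.
have := bex_prod p (fun k b => if k == i then g b else 1).
rewrite [RHS](bigD1 i) //= eqxx [X in _ * X]big1 ?mulr1 => [<-|k /negPf ->]; last first.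
  by rewrite !mulr1; ring.
by apply: eq_bex => Y; rewrite (bigD1 i) //= eqxx big1 ?mulr1 // => k /negPf ->.
Qed.

Definition depends_on {R : realType} {I : finType} (A : {set I}) (F : {ffun I -> bool} -> R) :=
  forall Y Y' : {ffun I -> bool}, {in A, Y =1 Y'} -> F Y = F Y'.

(* Exchanging the coordinates in A of two independent copies (Y, Y') preserves their joint law. *)
Lemma bex_indep {R : realType} {I : finType} (p : I -> R) (A : {set I}) F G :
  depends_on A F -> depends_on (~: A) G ->
  bex p (fun Y => F Y * G Y) = bex p F * bex p G.
Proof.
move=> dF dG.
pose mix (Y Y' : {ffun I -> bool}) := [ffun i => if i \in A then Y i else Y' i].
pose sw (u : {ffun I -> bool} * {ffun I -> bool}) := (mix u.1 u.2, mix u.2 u.1).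
have swK : involutive sw.
  by move=> [Y Y']; congr pair; apply/ffunP => i; rewrite !ffunE /=; case: ifP => h; rewrite ?ffunE ?h.
have wsw u : bweight p (sw u).1 * bweight p (sw u).2 = bweight p u.1 * bweight p u.2.
  rewrite /bweight -!big_split; apply: eq_bigr => i _ /=; rewrite !ffunE.
  by case: (i \in A) => //; rewrite mulrC.
rewrite -[LHS]mulr1 -(bweight_sum p) /bex !big_distrlr /= !pair_big /=.
rewrite (reindex_inj (inv_inj swK)) /=; apply: eq_bigr => -[Y Y'] _ /=.
have -> : F (mix Y Y') = F Y by apply: dF => i iA; rewrite ffunE iA.
have -> : G (mix Y Y') = G Y'.
  by apply: dG => i; rewrite inE ffunE => /negPf ->.
by have /= := wsw (Y, Y') => h; rewrite -[RHS]mulrACA -h; ring.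
Qed.

Lemma bex_prod_indep {R : realType} {I : finType} (p : I -> R) (P : {set {set I}})
    (F : {set I} -> {ffun I -> bool} -> R) :
  finset.trivIset P -> (forall J, J \in P -> depends_on J (F J)) ->
  bex p (fun Y => \prod_(J in P) F J Y) = \prod_(J in P) bex p (F J).
Proof.
move=> /finset.trivIsetP tP dF.
have key (s : seq {set I}) : uniq s -> {subset s <= P} ->
    bex p (fun Y => \prod_(J <- s) F J Y) = \prod_(J <- s) bex p (F J).
  elim: s => [_ _|J s IH /= /andP[Js us] sP].
    by rewrite big_nil -[RHS](bex_cst p); apply: eq_bex => Y; rewrite big_nil.
  have JP : J \in P by rewrite sP ?mem_head.
  rewrite big_cons -IH //; last by move=> K Ks; rewrite sP // inE Ks orbT.
  rewrite -(@bex_indep _ _ _ J); first by apply: eq_bex => Y; rewrite big_cons.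
    exact: dF.
  move=> Y Y' h; rewrite !big_seq; apply: eq_bigr => K Ks.
  have KP : K \in P by rewrite sP // inE Ks orbT.
  apply: (dF K KP) => i iK; apply: h; rewrite inE.
  have JK : J != K by apply: contraNneq Js => ->.
  by rewrite (disjointFl (tP J K JP KP JK)).
rewrite -[RHS]big_enum -key ?enum_uniq // => [|J]; last by rewrite mem_enum.
by apply: eq_bex => Y; rewrite big_enum.
Qed.

Lemma bex_sqr_sum {R : realType} {I : finType} (p : I -> R) (J : {set I}) :
  bex p (fun Y => (\sum_(i in J) (bit R (Y i) - p i)) ^+ 2) = \sum_(i in J) p i * (1 - p i).
Proof.
have -> : bex p (fun Y => (\sum_(i in J) (bit R (Y i) - p i)) ^+ 2) =
  \sum_(i in J) \sum_(j in J) bex p (fun Y => (bit R (Y i) - p i) * (bit R (Y j) - p j)).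
  under [RHS]eq_bigr do rewrite -bex_sum.
  by rewrite -bex_sum; apply: eq_bex => Y; rewrite expr2 big_distrlr.
apply: eq_bigr => i iJ; rewrite (bigD1 i) //= big1 ?addr0.
  by rewrite (bex_coord p i (fun b => (bit R b - p i) * (bit R b - p i))) /bit; ring.
move=> j /andP[_ ji].
rewrite (@bex_indep _ _ _ [set i]).
- by rewrite (bex_coord p i (fun b => bit R b - p i)) /bit; ring.
- by move=> Y Y' h; rewrite h ?inE.
- by move=> Y Y' h; rewrite h ?inE.
Qed.

(** * Exponential moments of the deviation on one block *)

Lemma tail_sqrt {R : realType} (Om : finType) (w : Om -> R) (X : Om -> nat) (U : pred nat)
    (z : nat -> R) (N : nat) :
  (forall o, 0 <= w o) -> (forall o, (X o <= N)%N) ->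
  (forall k, U k -> expR (z k) * (\sum_(o | U (X o) && (k <= X o)%N) w o) <= 1) ->
  \sum_(o | U (X o)) w o * expR (z (X o) / 2) <= 2 * Num.sqrt (\sum_(o | U (X o)) w o).
Proof.
move=> w0 XN hz.
pose G k := \sum_(o | U (X o) && (k <= X o)%N) w o.
pose H k := \sum_(o | U (X o) && (k <= X o)%N) w o * expR (z (X o) / 2).
have G0 k : 0 <= G k by exact: sumr_ge0.
(* Downward induction on k, telescoping. If a^2 and b^2 are the masses of X >= k and X >= k + 1
   within U, the atom at k weighs a^2 - b^2 and exp (z k / 2) a <= 1, so it contributes at most 2 (a
   - b). *)
suff key d k : (N.+1 - k <= d)%N -> H k <= 2 * Num.sqrt (G k).
  by have := key _ 0%N (leqnn _); rewrite /H /G; under eq_bigl do rewrite leq0n andbT;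
     under [in X in _ <= X]eq_bigl do rewrite leq0n andbT.
elim: d k => [|d IH] k hk.
  rewrite /H big1 ?mulr_ge0 ?sqrtr_ge0 // => o /andP[_ ko].
  by have := leq_trans ko (XN o); rewrite leqNgt; move: hk; rewrite leqn0 subn_eq0 => ->.
have {}IH : H k.+1 <= 2 * Num.sqrt (G k.+1) by apply: IH; rewrite subnS; case: (N.+1 - k)%N hk.
have split (f : Om -> R) : \sum_(o | U (X o) && (k <= X o)%N) f o =
    \sum_(o | U (X o) && (X o == k)) f o + \sum_(o | U (X o) && (k < X o)%N) f o.
  rewrite (bigID (fun o => X o == k)) /=; congr (_ + _); apply: eq_bigl => o.
    by case: eqP => [->|]; rewrite ?leqnn ?andbT ?andbF.
  by rewrite [(k < _)%N]ltn_neqAle eq_sym -andbA [in LHS](andbC (k <= _)%N).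
have [Uk|nUk] := boolP (U k); last first.
  have e : forall f : Om -> R, \sum_(o | U (X o) && (X o == k)) f o = 0.
    by move=> f; rewrite big1 // => o /andP[+ /eqP Xk]; rewrite Xk (negPf nUk).
  by rewrite /H /G !split !e !add0r.
have gk : \sum_(o | U (X o) && (X o == k)) w o = G k - G k.+1 by rewrite /G split addrK.
have -> : H k = (G k - G k.+1) * expR (z k / 2) + H k.+1.
  rewrite /H split; congr (_ + _); rewrite -gk mulr_suml.
  by apply: eq_bigr => o /andP[_ /eqP ->].
have ab : G k.+1 <= G k by rewrite -subr_ge0 -gk sumr_ge0.
set a := Num.sqrt (G k); set b := Num.sqrt (G k.+1) in IH *.
have a0 : 0 <= a by rewrite sqrtr_ge0.
have b0 : 0 <= b by rewrite sqrtr_ge0.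
have ba : b <= a by rewrite ler_sqrt.
have -> : G k = a ^+ 2 by rewrite sqr_sqrtr.
have -> : G k.+1 = b ^+ 2 by rewrite sqr_sqrtr.
have e0 := expR_ge0 (z k / 2).
have ae : expR (z k / 2) * a <= 1.
  rewrite -(@ler_pXn2r _ 2) ?nnegrE ?mulr_ge0 // expr1n exprMn sqr_sqrtr //.
  by rewrite -expRM_natl [2 * _]mulrC divfK // hz.
apply: (@le_trans _ _ (2 * (a - b) + 2 * b)); last by lra.
apply: lerD => //; rewrite subr_sqr -mulrA [2 * _]mulrC ler_wpM2l ?subr_ge0 //.
by nra.
Qed.

Definition savg {R : realType} {I : finType} (J : {set I}) (v : I -> R) : R :=
  (\sum_(i in J) v i) / #|J|%:R.

Definition cnt {I : finType} (J : {set I}) (Y : {ffun I -> bool}) : nat :=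
  (\sum_(i in J) Y i)%N.

Lemma savg_bit {R : realType} {I : finType} (J : {set I}) (Y : {ffun I -> bool}) :
  savg J (fun i => bit R (Y i)) = (cnt J Y)%:R / #|J|%:R.
Proof.
congr (_ / _); rewrite /cnt natr_sum; apply: eq_bigr => i _.
by rewrite /bit; case: (Y i).
Qed.

Lemma cntC {I : finType} (J : {set I}) (Y : {ffun I -> bool}) :
  (cnt J Y + \sum_(i in J) ~~ Y i)%N = #|J|.
Proof.
by rewrite /cnt -big_split -sum1_card /=; apply: eq_bigr => i _; case: (Y i).
Qed.

Lemma cnt_le {I : finType} (J : {set I}) (Y : {ffun I -> bool}) : (cnt J Y <= #|J|)%N.
Proof. by rewrite -(cntC J Y) leq_addr. Qed.

Lemma savg_itv {R : realType} {I : finType} (J : {set I}) (v : I -> R) (a b : R) :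
  (0 < #|J|)%N -> (forall i, a <= v i <= b) -> a <= savg J v <= b.
Proof.
move=> J0 h; rewrite /savg ler_pdivlMr ?ltr0n // ler_pdivrMr ?ltr0n //.
rewrite !mulr_natr -!sumr_const.
by apply/andP; split; apply: ler_sum => i _; have /andP[] := h i.
Qed.

(** By independence the expectation is the product of p_i x + (1 - p_i) y over the block, and the
    arithmetic-geometric inequality bounds it by a power of the mean factor, which is 1. This is how
    unequal p_i inside a block are compared with their average. *)
Lemma bex_cnt_le1 {R : realType} {I : finType} (p : I -> R) (J : {set I}) (x y : R) :
  (0 < #|J|)%N -> (forall i, 0 <= p i <= 1) -> 0 <= x -> 0 <= y ->
  savg J p * x + (1 - savg J p) * y = 1 ->
  bex p (fun Y => x ^+ cnt J Y * y ^+ (#|J| - cnt J Y)) <= 1.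
Proof.
move=> J0 p01 x0 y0 h.
have -> : bex p (fun Y => x ^+ cnt J Y * y ^+ (#|J| - cnt J Y)) =
    bex p (fun Y => \prod_i (fun i b => if i \in J then if b then x else y else 1) i (Y i)).
  apply: eq_bex => Y; rewrite -(cntC J Y) addKn /cnt -!prodrXr -big_split /=.
  rewrite [LHS]big_mkcond; apply: eq_bigr => i _; case: ifP => // _.
  by case: (Y i); rewrite ?expr0 ?expr1 ?mulr1 ?mul1r.
rewrite (bex_prod p (fun i b => if i \in J then if b then x else y else 1)) /=.
have -> : \prod_i (p i * (if i \in J then x else 1) + (1 - p i) * (if i \in J then y else 1)) =
    \prod_(i in J) (p i * x + (1 - p i) * y).
  by rewrite [RHS]big_mkcond; apply: eq_bigr => i _; case: ifP => // _; ring.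
have := @leif_AGM R _ (mem J) (fun i => p i * x + (1 - p i) * y).
case=> [i _|+ _].
  by have /andP[? ?] := p01 i; rewrite addr_ge0 // mulr_ge0 //; lra.
move=> /le_trans; apply.
rewrite (_ : (\sum_(i in mem J) _) / _ = 1) ?expr1n //.
rewrite -[RHS]h /savg big_split /= -!mulr_suml sumrB sumr_const.
by field; rewrite pnatr_eq0 -lt0n.
Qed.

Lemma expR_natM_ln {R : realType} (k : nat) (x : R) : 0 < x \/ k = 0%N ->
  expR (k%:R * ln x) = x ^+ k.
Proof.
by case=> [x0|->]; [rewrite expRM_natl lnK | rewrite mul0r expR0 expr0].
Qed.

Lemma expR_kl {R : realType} (a : R) (k N : nat) : 0 < a < 1 -> (0 < N)%N -> (k <= N)%N ->
  expR (N%:R * kl (k%:R / N%:R) a) =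
  (k%:R / N%:R / a) ^+ k * ((1 - k%:R / N%:R) / (1 - a)) ^+ (N - k).
Proof.
move=> /andP[a0 a1] N0 kN; have N0' : 0 < N%:R :> R by rewrite ltr0n.
have qE : 1 - k%:R / N%:R = (N - k)%:R / N%:R :> R.
  by rewrite natrB //; field; rewrite gt_eqF.
have e (u v : R) : N%:R * (u / N%:R * v) = u * v by field; rewrite gt_eqF.
rewrite /kl qE mulrDr !e expRD.
rewrite !expR_natM_ln //.
- case: (posnP (N - k)%N) => h; [by right|left].
  by rewrite !divr_gt0 ?ltr0n ?subr_gt0.
- case: (posnP k) => h; [by right|left].
  by rewrite !divr_gt0 ?ltr0n.
Qed.

Lemma exprM_mono {R : realType} (x y : R) (k c N : nat) : 0 <= y -> y <= x ->
  (k <= c)%N -> (c <= N)%N -> x ^+ k * y ^+ (N - k) <= x ^+ c * y ^+ (N - c).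
Proof.
move=> y0 yx kc cN; have x0 := le_trans y0 yx.
have -> : (N - k = (c - k) + (N - c))%N by rewrite addnC addnBA // subnK.
have -> : x ^+ c = x ^+ k * x ^+ (c - k) by rewrite -exprD subnKC.
rewrite exprD -mulrA ler_wpM2l ?exprn_ge0 // ler_wpM2r ?exprn_ge0 //.
by rewrite lerXn2r ?nnegrE.
Qed.

(** Markov's inequality for the likelihood ratio x^cnt y^(|J| - cnt), where x and y are the ratios
    of k / |J| to a for success and for failure: its mean is at most 1, and on P it is at least its
    value at cnt = k, which is the exponential of |J| kl. The disjunction covers the upper and the
    lower tail. *)
Lemma chernoff {R : realType} {I : finType} (p : I -> R) (J : {set I})
    (P : pred {ffun I -> bool}) (k : nat) (a := savg J p) :
  (0 < #|J|)%N -> (forall i, 0 <= p i <= 1) -> 0 < a < 1 -> (k <= #|J|)%N ->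
  (forall Y, P Y -> (k <= cnt J Y)%N /\ a <= k%:R / #|J|%:R \/
                    (cnt J Y <= k)%N /\ k%:R / #|J|%:R <= a) ->
  expR (#|J|%:R * kl (k%:R / #|J|%:R) a) * (\sum_(Y | P Y) bweight p Y) <= 1.
Proof.
move=> J0 p01 /andP[a0 a1] kN hP; rewrite expR_kl ?a0 ?a1 //.
set x := _ / a; set y := _ / (1 - a).
have q0 : 0 <= k%:R / #|J|%:R :> R by rewrite divr_ge0.
have q1 : k%:R / #|J|%:R <= 1 :> R by rewrite ler_pdivrMr ?ltr0n // mul1r ler_nat.
have x0 : 0 <= x by rewrite divr_ge0 // ltW.
have y0 : 0 <= y by rewrite divr_ge0 // subr_ge0 // ltW.
have xy : a * x + (1 - a) * y = 1.
  by rewrite /x /y; field; rewrite !gt_eqF ?ltr0n ?subr_gt0.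
apply: le_trans (@bex_cnt_le1 _ _ p J x y J0 p01 x0 y0 xy).
rewrite mulr_sumr big_mkcond; apply: ler_sum => Y _.
have w0 := bweight_ge0 p Y p01; have cN := cnt_le J Y.
case: ifP => [PY|_]; last by rewrite mulr_ge0 // mulr_ge0 // exprn_ge0.
rewrite mulrC ler_wpM2l //; have [[kc qa]|[ck qa]] := hP Y PY.
  apply: exprM_mono => //; rewrite /x /y ler_pdivrMr ?subr_gt0 // mulrAC ler_pdivlMr //.
  by nra.
have h : y ^+ (#|J| - k) * x ^+ (#|J| - (#|J| - k)) <=
    y ^+ (#|J| - cnt J Y) * x ^+ (#|J| - (#|J| - cnt J Y)).
  apply: exprM_mono; rewrite ?leq_sub2l ?leq_subr //.
  by rewrite /x /y ler_pdivlMr ?subr_gt0 // mulrAC ler_pdivrMr //; nra.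
by rewrite !subKn // in h; rewrite mulrC [leRHS]mulrC.
Qed.

(** The contribution of the block J to n K(q, r). *)
Definition Zdev {R : realType} {I : finType} (p : I -> R) (J : {set I}) (Y : {ffun I -> bool}) : R :=
  #|J|%:R * kl (savg J (fun i => bit R (Y i))) (savg J p).

(** Above and below the mean, [chernoff] feeds [tail_sqrt], for a total of 2 (s + t) where s^2 and
    t^2 are the masses of the two events. Since s^2 + t^2 = 1, s + t <= sqrt 2 <= 3/2. *)
Lemma bex_Zdev_half {R : realType} {I : finType} (p : I -> R) (J : {set I}) :
  (0 < #|J|)%N -> (forall i, 0 <= p i <= 1) -> 0 < savg J p < 1 ->
  bex p (fun Y => expR (Zdev p J Y / 2)) <= 3.
Proof.
move=> J0 p01 a01; set a := savg J p; set N := #|J|.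
have N0 : 0 < N%:R :> R by rewrite ltr0n.
pose z k : R := N%:R * kl (k%:R / N%:R) a.
pose U := [pred k : nat | a <= k%:R / N%:R].
have w0 Y := bweight_ge0 p Y p01.
have up : \sum_(Y | U (cnt J Y)) bweight p Y * expR (z (cnt J Y) / 2)
    <= 2 * Num.sqrt (\sum_(Y | U (cnt J Y)) bweight p Y).
  apply: (@tail_sqrt _ _ _ _ U z N) => // [Y|k Uk]; first exact: cnt_le.
  have [kN|kN] := leqP k N.
    by apply: chernoff => // Y /andP[_ kc]; left.
  rewrite big1 ?mulr0 // => Y /andP[_ kc].
  by have := leq_trans kc (cnt_le J Y); rewrite leqNgt kN.
have dn : \sum_(Y | ~~ U (cnt J Y)) bweight p Y * expR (z (cnt J Y) / 2)
    <= 2 * Num.sqrt (\sum_(Y | ~~ U (cnt J Y)) bweight p Y).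
  (* Counting failures instead of successes turns the lower tail into an upper one. *)
  have e Y : (N - (N - cnt J Y))%N = cnt J Y by rewrite subKn // cnt_le.
  have eU Y : ~~ U (cnt J Y) = ~~ U (N - (N - cnt J Y))%N by rewrite e.
  rewrite !(eq_bigl _ _ eU) (eq_bigr (fun Y => bweight p Y * expR (z (N - (N - cnt J Y))%N / 2)));
    last by move=> Y _; rewrite e.
  apply: (@tail_sqrt R _ (bweight p) (fun Y => (N - cnt J Y)%N) (fun k => ~~ U (N - k)%N)
    (fun k => z (N - k)%N) N w0 (fun Y => leq_subr _ _)).
  move=> k Uk; apply: chernoff => //; first exact: leq_subr.
  move=> Y /andP[_ kc]; right; split.
    have cN := cnt_le J Y; have kN := leq_trans kc (leq_subr _ _).
    by rewrite leq_subRL // addnC -leq_subRL.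
  by move: Uk; rewrite /= -ltNge => /ltW.
rewrite /bex (bigID (fun Y => U (cnt J Y))) /=.
under eq_bigr do rewrite /Zdev savg_bit -/N -/a.
under [X in _ + X]eq_bigr do rewrite /Zdev savg_bit -/N -/a.
have := bweight_sum p; rewrite (bigID (fun Y => U (cnt J Y))) /=.
move: up dn; rewrite /z /=.
set A := \sum_(Y | _) _ => up; set B := \sum_(Y | _) _ => dn.
have A0 : 0 <= \sum_(Y | a <= (cnt J Y)%:R / N%:R) bweight p Y by exact: sumr_ge0.
have B0 : 0 <= \sum_(Y | ~~ (a <= (cnt J Y)%:R / N%:R)) bweight p Y by exact: sumr_ge0.
have := sqr_sqrtr A0; have := sqr_sqrtr B0.
have := sqrtr_ge0 (\sum_(Y | a <= (cnt J Y)%:R / N%:R) bweight p Y).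
have := sqrtr_ge0 (\sum_(Y | ~~ (a <= (cnt J Y)%:R / N%:R)) bweight p Y).
move: up dn.
move: (Num.sqrt _) (Num.sqrt _) => s t hA hB t0 s0 hs ht hst.
suff : s + t <= 3 / 2 by lra.
have : 0 <= (s - t) ^+ 2 by rewrite sqr_ge0.
by nra.
Qed.

Lemma savg01 {R : realType} {I : finType} (J : {set I}) (v : I -> R) :
  (forall i, 0 <= v i <= 1) -> 0 <= savg J v <= 1.
Proof.
move=> h; have [J0|J0] := posnP #|J|; last exact: savg_itv.
by rewrite /savg J0 invr0 mulr0 lexx ler01.
Qed.

Lemma Zdev_ge0 {R : realType} {I : finType} (p : I -> R) (J : {set I}) (Y : {ffun I -> bool}) :
  0 < savg J p < 1 -> 0 <= Zdev p J Y.
Proof.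
move=> a01; rewrite mulr_ge0 // kl_ge0 // savg01 // => i.
by rewrite /bit; case: (Y i); rewrite lexx ler01.
Qed.

(** Jensen for the square root, through its tangent line at (7/4)^2: the mean is at most 7/8 + 2/7 *
    3 < 7/4. *)
Lemma bex_Zdev_quarter {R : realType} {I : finType} (p : I -> R) (J : {set I}) :
  (0 < #|J|)%N -> (forall i, 0 <= p i <= 1) -> 0 < savg J p < 1 ->
  bex p (fun Y => expR (Zdev p J Y / 4)) <= 7 / 4.
Proof.
move=> J0 p01 a01; have h3 := bex_Zdev_half p J J0 p01 a01.
apply: (@le_trans _ _ (bex p (fun Y => 7 / 8 + 2 / 7 * expR (Zdev p J Y / 2)))).
  apply: bex_le => // Y.
  have -> : expR (Zdev p J Y / 2) = expR (Zdev p J Y / 4) ^+ 2.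
    by rewrite -expRM_natl; congr expR; lra.
  by have : 0 <= (expR (Zdev p J Y / 4) - 7 / 4) ^+ 2; [exact: sqr_ge0 | lra].
by rewrite bexD bex_cst bexZ; lra.
Qed.

(** The variance of the block sum is the sum of the p_i (1 - p_i), which falls short of |J| a (1 -
    a) by exactly the sum of the (p_i - a)^2. *)
Lemma bex_chi2 {R : realType} {I : finType} (p : I -> R) (J : {set I}) (a := savg J p) :
  (0 < #|J|)%N -> 0 < a < 1 ->
  bex p (fun Y => #|J|%:R * ((savg J (fun i => bit R (Y i)) - a) ^+ 2 / (a * (1 - a)))) <= 1.
Proof.
move=> J0 /andP[a0 a1]; have N0 : 0 < #|J|%:R :> R by rewrite ltr0n.
have v0 : 0 < a * (1 - a) by rewrite mulr_gt0 // subr_gt0.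
have SE : \sum_(i in J) p i = a * #|J|%:R by rewrite /a /savg divfK // gt_eqF.
have -> : bex p (fun Y => #|J|%:R * ((savg J (fun i => bit R (Y i)) - a) ^+ 2 / (a * (1 - a)))) =
    bex p (fun Y => (a * (1 - a) * #|J|%:R)^-1 * (\sum_(i in J) (bit R (Y i) - p i)) ^+ 2).
  apply: eq_bex => Y; rewrite sumrB SE /savg.
  by field; rewrite !gt_eqF // subr_gt0.
have v1 : 0 < a * (1 - a) * #|J|%:R by exact: mulr_gt0.
rewrite bexZ bex_sqr_sum ler_pdivrMl // mulr1.
have : 0 <= \sum_(i in J) (p i - a) ^+ 2 by apply: sumr_ge0 => i _; exact: sqr_ge0.
have -> : \sum_(i in J) (p i - a) ^+ 2 =
    (1 - 2 * a) * (\sum_(i in J) p i) + a ^+ 2 * #|J|%:R - \sum_(i in J) p i * (1 - p i).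
  rewrite mulr_sumr -[#|J|]sum1_card natr_sum mulr_sumr -big_split -sumrB /=.
  by apply: eq_bigr => i _; ring.
by rewrite SE; lra.
Qed.

(* When q is far from a, N kl(q, a) is so large that it is dominated by a small multiple of
   its own exponential; otherwise kl is at most 7/10 of the chi-square divergence. *)
Lemma kl_trunc {R : realType} (N rho a q : R) : 0 < N -> 0 < rho ->
  rho <= a <= 1 - rho -> 0 <= q <= 1 -> 9000 <= N * rho ^+ 2 ->
  N * kl q a <= 7 / 10 * (N * ((q - a) ^+ 2 / (a * (1 - a))))
    + 1 / 50 * (expR (N * kl q a / 2) - 1).
Proof.
move=> N0 rho0 /andP[a0 a1] q01 hN.
have a01 : 0 < a < 1 by apply/andP; split; lra.
have z0 : 0 <= N * kl q a by rewrite mulr_ge0 ?(ltW N0) // kl_ge0.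
have z20 : 0 <= N * kl q a / 2 by rewrite divr_ge0.
have ge2 : 1 + (N * kl q a / 2) ^+ 2 / 2 <= expR (N * kl q a / 2).
  exact: (@expR_ge1Dxn _ _ 1).
(* Within 3/10 rho of a, q >= 7/10 a and 1 - q >= 7/10 (1 - a), as a and 1 - a are at least rho; so
   [kl_le_chi2] applies. *)
have [hq|hq] := lerP ((q - a) ^+ 2) ((3 / 10 * rho) ^+ 2).
  have hkl : kl q a <= 7 / 10 * ((q - a) ^+ 2 / (a * (1 - a))).
    have r0 : 0 <= 3 / 10 * rho by lra.
    move: hq; rewrite -ler_sqrt ?sqr_ge0 // !sqrtr_sqr (ger0_norm r0) ler_norml.
    by clear -a01 a0 a1 rho0 => /andP[h1 h2]; apply: kl_le_chi2 => //; lra.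
  have hz : N * kl q a <= N * (7 / 10 * ((q - a) ^+ 2 / (a * (1 - a)))) by rewrite ler_pM2l.
  have := sqr_ge0 (N * kl q a / 2); rewrite [7 / 10 * (N * _)]mulrCA.
  by move: (expR _) ((_ / 2) ^+ 2) (N * (7 / 10 * _)) ge2 hz => E F G; clear; lra.
have chi0 : 0 <= N * ((q - a) ^+ 2 / (a * (1 - a))).
  move/andP: a01 => [? ?].
  by rewrite mulr_ge0 ?(ltW N0) // divr_ge0 ?sqr_ge0 // mulr_ge0 ?subr_ge0 ?ltW.
(* Here N kl >= N (q - a)^2 / 2 >= 9000 * 9/200 = 405. From z = 400 on, z <= z^2 / 400 <= (exp (z /
   2) - 1) / 50. *)
have h400 : 400 <= N * kl q a.
  apply: (@le_trans _ _ (N * ((q - a) ^+ 2 / 2))).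
    apply: (@le_trans _ _ (N * ((3 / 10 * rho) ^+ 2 / 2))).
      by clear -hN; lra.
    by rewrite ler_pM2l // ler_pM2r // ltW.
  rewrite ler_pM2l //; apply: le_trans (kl_ge_hd _ _ q01 a01).
  by rewrite hdC; apply: hd_ge_sqr => //; rewrite !ltW //; case/andP: a01.
move: (N * kl q a) (N * ((q - a) ^+ 2 / _)) ge2 h400 chi0 => z G.
by move: (expR _) => E; clear; nra.
Qed.

(** The logarithm of the moment of order 1/52 stays below 1/52: this is the budget 1 per block. The
    chi-square part gives 7/520 and the exponential part 2 (1/2600 + 12/5000), in all about 0.0190,
    against 1/52 = 0.0192. *)
Lemma bex_Zdev_small {R : realType} {I : finType} (p : I -> R) (J : {set I}) (rho : R) :
  (0 < #|J|)%N -> 0 < rho -> (forall i, rho <= p i <= 1 - rho) ->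
  9000 <= #|J|%:R * rho ^+ 2 ->
  bex p (fun Y => expR (Zdev p J Y / 52)) <= expR (52^-1).
Proof.
move=> J0 rho0 hp hN.
have p01 i : 0 <= p i <= 1 by have := hp i; lra.
have hrho := savg_itv J p _ _ J0 hp.
have a01 : 0 < savg J p < 1 by lra.
apply: (@le_trans _ _ (1 + 52^-1)); last exact: expR_ge1Dx.
have hhalf := bex_Zdev_half p J J0 p01 a01.
have hchi := bex_chi2 p J J0 a01.
pose chi (Y : {ffun I -> bool}) : R := #|J|%:R * ((savg J (fun i => bit R (Y i)) - savg J p) ^+ 2 / (savg J p * (1 - savg J p))).
apply: (@le_trans _ _ (bex p (fun Y => (1 - 1 / 2600 - 12 / 5000) + 7 / 520 * chi Y
    + (1 / 2600 + 12 / 5000) * expR (Zdev p J Y / 2)))).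
  apply: bex_le => // Y.
  have := expR_interp _ (Zdev_ge0 p J Y a01).
  have : Zdev p J Y <= 7 / 10 * chi Y + 1 / 50 * (expR (Zdev p J Y / 2) - 1).
    apply: (@kl_trunc _ _ rho) => //; first by rewrite ltr0n.
    by apply: savg01 => i; rewrite /bit; case: (Y i); rewrite lexx ler01.
  by move: (chi Y) (Zdev p J Y) (expR (_ / 2)) (expR (_ / 52)) => c z e f; clear; lra.
have {}hchi : bex p chi <= 1 by exact: hchi.
rewrite (bexD p (fun Y => _ + 7 / 520 * chi Y)) (bexD p (fun=> _)) bex_cst (bexZ p (7 / 520) chi) (bexZ p _ (fun Y => expR _)).
move: (bex p chi) (bex p (fun Y => expR _)) hchi hhalf => A B. clear; lra.
Qed.

(** * Partitions, block averages and the models *)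

Definition bavg {R : realType} {I : finType} (m : {set {set I}}) (v : I -> R) (i : I) : R :=
  savg (finset.pblock m i) v.

Lemma partition_card_gt0 {I : finType} (m : {set {set I}}) (J : {set I}) :
  finset.partition m [set: I] -> J \in m -> (0 < #|J|)%N.
Proof.
by case/and3P=> _ _ h Jm; rewrite card_gt0; apply: contraNneq h => <-.
Qed.

Lemma pblock_in {I : finType} (m : {set {set I}}) (i : I) :
  finset.partition m [set: I] -> finset.pblock m i \in m /\ i \in finset.pblock m i.
Proof.
case/and3P=> /eqP cm _ _.
by rewrite finset.pblock_mem ?cm ?finset.mem_pblock ?cm ?inE.
Qed.

Lemma pblockE {I : finType} (m : {set {set I}}) (J : {set I}) (i : I) :
  finset.partition m [set: I] -> J \in m -> i \in J -> finset.pblock m i = J.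
Proof. by case/and3P=> _ tm _; exact: finset.def_pblock. Qed.

Lemma sum_blocks {R : realType} {I : finType} (m : {set {set I}}) (F : I -> R) :
  finset.partition m [set: I] -> \sum_i F i = \sum_(J in m) \sum_(i in J) F i.
Proof.
move=> hm; rewrite -(finset.set_partition_big _ hm) /=.
by apply: eq_bigl => i; rewrite inE.
Qed.

Lemma sum_pblock {R : realType} {I : finType} (m : {set {set I}}) (g : {set I} -> R) :
  finset.partition m [set: I] ->
  \sum_i g (finset.pblock m i) = \sum_(J in m) #|J|%:R * g J.
Proof.
move=> hm; rewrite (sum_blocks _ _ hm); apply: eq_bigr => J Jm.
rewrite mulr_natl -sumr_const; apply: eq_bigr => i iJ.
by rewrite (pblockE _ _ _ hm Jm iJ).
Qed.

(** Block averaging is the orthogonal projection onto the functions constant on blocks, so it leaves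
    sums against them unchanged. *)
Lemma sum_bavg {R : realType} {I : finType} (m : {set {set I}}) (v : I -> R)
    (g : {set I} -> R) : finset.partition m [set: I] ->
  \sum_i v i * g (finset.pblock m i) = \sum_i bavg m v i * g (finset.pblock m i).
Proof.
move=> hm; rewrite (@sum_pblock _ _ m (fun J => savg J v * g J)) //.
rewrite (sum_blocks _ _ hm); apply: eq_bigr => J Jm.
have J0 : #|J|%:R != 0 :> R by rewrite pnatr_eq0 -lt0n (partition_card_gt0 _ _ hm Jm).
rewrite /savg mulrA [#|J|%:R * _]mulrC divfK // mulr_suml.
by apply: eq_bigr => i iJ; rewrite (pblockE _ _ _ hm Jm iJ).
Qed.

Lemma S_pblock {R : realType} {n : nat} (m : {set {set 'I_n}}) (f : 'I_n -> R) :
  finset.partition m [set: 'I_n] ->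
  S_ m f <-> exists c, f = fun i => c (finset.pblock m i).
Proof.
move=> hm.
have e c i : \sum_(J in m) c J * (if i \in J then 1 else 0) = c (finset.pblock m i) :> R.
  have [bm ib] := pblock_in m i hm.
  rewrite (bigD1 _ bm) /= ib mulr1 big1 ?addr0 // => J /andP[Jm Jb].
  by case: ifP => iJ; rewrite ?mulr0 //; move: Jb; rewrite (pblockE _ _ _ hm Jm iJ) eqxx.
by split=> -[c ->]; exists c; apply/funext => i; rewrite e.
Qed.

(** * The logistic link; explicit estimators and projections *)

Lemma pi_itv {R : realType} {n : nat} (f : 'I_n -> R) i : 0 < pi_ f i < 1.
Proof.
have e0 := expR_gt0 (f i); have s0 : 0 < 1 + expR (f i) by lra.
by rewrite divr_gt0 //= ltr_pdivrMr //; lra.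
Qed.

Lemma one_sub_pi {R : realType} {n : nat} (f : 'I_n -> R) i : 1 - pi_ f i = (1 + expR (f i))^-1.
Proof.
have e0 := expR_gt0 (f i); have s0 : 0 < 1 + expR (f i) by lra.
by rewrite /pi_; field; rewrite gt_eqF.
Qed.

Lemma ln_pi {R : realType} {n : nat} (f : 'I_n -> R) i :
  ln (pi_ f i) = f i - ln (1 + expR (f i)).
Proof.
have e0 := expR_gt0 (f i); have s0 : 0 < 1 + expR (f i) by lra.
by rewrite ln_div ?posrE // expRK.
Qed.

Lemma ln_one_sub_pi {R : realType} {n : nat} (f : 'I_n -> R) i :
  ln (1 - pi_ f i) = - ln (1 + expR (f i)).
Proof.
have e0 := expR_gt0 (f i); have s0 : 0 < 1 + expR (f i) by lra.
by rewrite one_sub_pi lnV ?posrE.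
Qed.

Lemma kl_pi {R : realType} {n : nat} (q : R) (f : 'I_n -> R) i : 0 <= q <= 1 ->
  kl q (pi_ f i) = ent q + ln (1 + expR (f i)) - q * f i.
Proof. by move=> q01; rewrite klE ?pi_itv // ln_pi ln_one_sub_pi; ring. Qed.

Definition logit {R : realType} {n : nat} (v : 'I_n -> R) (i : 'I_n) : R := ln (v i / (1 - v i)).

Lemma pi_logit {R : realType} {n : nat} (v : 'I_n -> R) i : 0 < v i < 1 -> pi_ (logit v) i = v i.
Proof.
move=> /andP[v0 v1]; rewrite /pi_ /logit lnK ?posrE ?divr_gt0 ?subr_gt0 //.
by field; rewrite gt_eqF ?subr_gt0 // gt_eqF // subrK.
Qed.

Lemma logit_bavg_S {R : realType} {n : nat} (m : {set {set 'I_n}}) (v : 'I_n -> R) :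
  finset.partition m [set: 'I_n] -> S_ m (logit (bavg m v)).
Proof.
by move=> hm; apply/(S_pblock _ _ hm); exists (fun J => ln (savg J v / (1 - savg J v))).
Qed.

Lemma bit01 {R : realType} (b : bool) : 0 <= bit R b <= 1.
Proof. by case: b; rewrite /bit lexx ler01. Qed.

Lemma bavg01 {R : realType} {I : finType} (m : {set {set I}}) (v : I -> R) i :
  (forall i, 0 <= v i <= 1) -> 0 <= bavg m v i <= 1.
Proof. exact: savg01. Qed.

(** For f constant on blocks, Y may be replaced by its block average q in the linear term, and what
    is left is [kl] up to the entropy of q. Minimizing the contrast thus means bringing pi_f to
    q. *)
Lemma gamma_nE {R : realType} {n : nat} (m : {set {set 'I_n}}) (Y : {ffun 'I_n -> bool})
    (f : 'I_n -> R) (q := bavg m (fun i => bit R (Y i))) :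
  finset.partition m [set: 'I_n] -> S_ m f ->
  gamma_n Y f = n%:R^-1 * (\sum_i kl (q i) (pi_ f i) - \sum_i ent (q i)).
Proof.
move=> hm /(S_pblock _ _ hm)[c fE]; congr (_ * _).
rewrite sumrB [in LHS]fE (sum_bavg _ _ c hm) -/q -!sumrB; apply: eq_bigr => i _.
rewrite kl_pi; last by apply: bavg01 => j; exact: bit01.
by rewrite [in RHS]fE; ring.
Qed.

(** A Pythagorean identity: a term free of f, plus the divergence from the block average of
    pi_{f_0}. *)
Lemma KL_E {R : realType} {n : nat} (m : {set {set 'I_n}}) (f0 f : 'I_n -> R)
    (pb := bavg m (pi_ f0)) :
  finset.partition m [set: 'I_n] -> S_ m f ->
  KL f0 f = n%:R^-1 * (\sum_i (ent (pi_ f0 i) - ent (pb i)) + \sum_i kl (pb i) (pi_ f i)).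
Proof.
move=> hm /(S_pblock _ _ hm)[c fE]; congr (_ * _).
have p01 i : 0 <= pi_ f0 i <= 1 by have /andP[? ?] := pi_itv f0 i; rewrite !ltW.
rewrite (eq_bigr (fun i => ent (pi_ f0 i) + ln (1 + expR (f i)) - pi_ f0 i * f i));
  last by move=> i _; exact: kl_pi.
rewrite [X in _ = _ + X](eq_bigr (fun i => ent (pb i) + ln (1 + expR (f i)) - pb i * f i));
  last by move=> i _; rewrite kl_pi ?bavg01.
have : \sum_i pi_ f0 i * f i = \sum_i pb i * f i by rewrite fE; exact: sum_bavg.
by rewrite !sumrB !big_split /= => ->; ring.
Qed.

Lemma KL_bavg_le {R : realType} {n : nat} (m : {set {set 'I_n}}) (f0 f : 'I_n -> R) :
  finset.partition m [set: 'I_n] -> S_ m f ->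
  (forall i, 0 < bavg m (pi_ f0) i < 1) ->
  KL f0 (logit (bavg m (pi_ f0))) <= KL f0 f.
Proof.
move=> hm Sf pb01; rewrite !(KL_E m) //; last exact: logit_bavg_S.
rewrite ler_wpM2l ?invr_ge0 // lerD2l; apply: ler_sum => i _.
have /andP[? ?] := pb01 i.
apply: (@le_trans _ _ 0); last by rewrite kl_ge0 ?pi_itv // !ltW.
rewrite pi_logit // /kl !divff ?gt_eqF ?subr_gt0 // ln1; lra.
Qed.

(** [is_mce] determines both values: the infimum is approached as pi_f tends to q, and along any
    minimizing sequence [kl] controls the squared distance to q. *)
Lemma mceE {R : realType} {n : nat} (m : {set {set 'I_n}}) (Y : {ffun 'I_n -> bool})
    (g : R) (qh : 'I_n -> R) (q := bavg m (fun i => bit R (Y i))) :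
  (0 < n)%N -> finset.partition m [set: 'I_n] -> is_mce m Y g qh ->
  g = - (n%:R^-1 * \sum_i ent (q i)) /\ (forall i, qh i = q i).
Proof.
move=> n0 hm [gmin [fk [Sfk [fkg fkq]]]].
have q01 i : 0 <= q i <= 1 by apply: bavg01 => j; exact: bit01.
have n0' : 0 < n%:R :> R by rewrite ltr0n.
set G := - _.
have gE f : S_ m f -> gamma_n Y f = n%:R^-1 * (\sum_i kl (q i) (pi_ f i)) + G.
  by move=> Sf; rewrite (gamma_nE m) // -/q mulrBr.
have gG : g = G.
  apply/eqP; rewrite eq_le; apply/andP; split; last first.
    apply: (cvgr_to_ge fkg); apply: nearW => k; rewrite gE // lerDr.
    by rewrite mulr_ge0 ?invr_ge0 // sumr_ge0 // => i _; rewrite kl_ge0 ?pi_itv.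
  rewrite leNgt; apply/negP => gG.
  (* The weight solves - ln (1 - e) = (g - G) / 2, so the mixture has contrast below g, a
     contradiction. *)
  pose e := 1 - expR (- ((g - G) / 2)).
  have e01 : 0 < e < 1.
    by rewrite /e subr_gt0 expR_lt1 ltrBlDr ltrDl expR_gt0; apply/andP; split => //; lra.
  pose v i := (1 - e) * q i + e / 2.
  have v01 i : 0 < v i < 1.
    by have := q01 i; move: e01; rewrite /v => /andP[e0 e1] /andP[? ?]; apply/andP; split; nra.
  have Sv : S_ m (logit v).
    apply/(S_pblock _ _ hm).
    pose w J : R := (1 - e) * savg J (fun i => bit R (Y i)) + e / 2.
    by exists (fun J => ln (w J / (1 - w J))).
  have := gmin _ Sv; rewrite gE //.
  have : n%:R^-1 * \sum_i kl (q i) (pi_ (logit v) i) <= (g - G) / 2.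
    rewrite ler_pdivrMl //.
    have -> : n%:R * ((g - G) / 2) = \sum_(i < n) (g - G) / 2.
      by rewrite sumr_const card_ord mulr_natl.
    apply: ler_sum => i _; rewrite pi_logit //.
    apply: le_trans (kl_mix_le _ _ (q01 i) e01) _.
    by rewrite /e opprB addrC subrK expRK opprK.
  lra.
split=> // i.
(* Limit of (pi_{f_k} - q)^2 <= 2 kl <= 2 n (gamma_n(f_k) - G); the right side vanishes since g =
   G. *)
have : (qh i - q i) * (qh i - q i) <= 2 * n%:R * (g - G).
  apply: (@ler_cvg_to _ \oo _ _ (fun k => (pi_ (fk k) i - q i) * (pi_ (fk k) i - q i))
    (fun k => 2 * n%:R * (gamma_n Y (fk k) - G))).
  - have hB : pi_ (fk k) i - q i @[k --> \oo] --> qh i - q i.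
      by apply: (cvgB (fkq i)); exact: cvg_cst.
    exact: (cvgM hB hB).
  - have hB : gamma_n Y (fk k) - G @[k --> \oo] --> g - G.
      by apply: (cvgB fkg); exact: cvg_cst.
    by apply: (cvgM _ hB); exact: cvg_cst.
  apply: nearW => k; rewrite gE // addrK.
  rewrite -mulrA mulVKf ?gt_eqF //.
  have p01 := pi_itv (fk k) i.
  have p01' : 0 <= pi_ (fk k) i <= 1 by case/andP: p01 => ? ?; rewrite !ltW.
  have h1 := hd_ge_sqr _ _ p01' (q01 i).
  have h2 := kl_ge_hd _ _ (q01 i) p01.
  have : kl (q i) (pi_ (fk k) i) <= \sum_i kl (q i) (pi_ (fk k) i).
    by rewrite (bigD1 i) //= lerDl sumr_ge0 // => j _; rewrite kl_ge0 ?pi_itv.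
  rewrite -expr2; lra.
rewrite gG subrr mulr0 -expr2 => h.
have := sqr_ge0 (qh i - q i) => h'.
by apply/eqP; rewrite -subr_eq0 -sqrf_eq0 eq_le h h'.
Qed.

(** * Deviations of the whole Kullback term against the penalty *)

Lemma expR_7_12 {R : realType} : 7 / 4 <= expR (7 / 12 : R).
Proof.
have -> : expR (7 / 12 : R) = expR (7 / 96) ^+ 8 by rewrite -expRM_natl; congr expR; lra.
apply: (@le_trans _ _ ((1 + 7 / 96) ^+ 8)); first by lra.
by apply: lerXn2r; rewrite ?nnegrE ?expR_ge0 ?expR_ge1Dx //; lra.
Qed.

Lemma bex_sum_Zdev {R : realType} {I : finType} (p : I -> R) (m : {set {set I}}) (l b : R) :
  finset.partition m [set: I] -> (forall i, 0 <= p i <= 1) ->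
  (forall J, J \in m -> bex p (fun Y => expR (Zdev p J Y * l)) <= expR b) ->
  bex p (fun Y => expR ((\sum_(J in m) Zdev p J Y) * l)) <= expR (b *+ #|m|).
Proof.
move=> hm p01 h; have /and3P[_ tm _] := hm.
have -> : bex p (fun Y => expR ((\sum_(J in m) Zdev p J Y) * l)) =
    bex p (fun Y => \prod_(J in m) expR (Zdev p J Y * l)).
  by apply: eq_bex => Y; rewrite mulr_suml expR_sum.
rewrite (@bex_prod_indep _ _ _ m (fun J Y => expR (Zdev p J Y * l))) //; last first.
  move=> J _ Y Y' YY'.
  have YE : savg J (fun i => bit R (Y i)) = savg J (fun i => bit R (Y' i)).
    by rewrite /savg; congr (_ / _); apply: eq_bigr => i iJ; rewrite YY'.
  by rewrite /Zdev YE.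
rewrite -sumr_const expR_sum; apply: ler_prod => J Jm.
rewrite h // andbT; apply: sumr_ge0 => Y _.
by rewrite mulr_ge0 ?bweight_ge0 // expR_ge0.
Qed.

(* Exponential majorant of the deviation of the chi-square-like statistic z above its penalty.
   For small L the term 8 sqrt L, for larger L the term 4 L, pays for the weight L. *)
Definition pen_excess {R : realType} (L D z : R) : R :=
  let c := if L <= 36^-1 then 52 else 4 in
  c * expR ((z - D * (1 + 4 * L + 8 * Num.sqrt L)) / c).

Lemma pen_excess_ge0 {R : realType} (L D z : R) : 0 <= pen_excess L D z.
Proof. by rewrite /pen_excess; case: ifP => _; rewrite mulr_ge0 // expR_ge0. Qed.

Lemma le_pen_excess {R : realType} (L D z : R) :
  z <= D * (1 + 4 * L + 8 * Num.sqrt L) + pen_excess L D z.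
Proof.
rewrite -lerBlDl /pen_excess; set u := z - _.
by case: ifP => _; [have := expR_ge1Dx (u / 52) | have := expR_ge1Dx (u / 4)]; lra.
Qed.

(** A moment bound exp b per block becomes exp (b D) by independence, so at scale c it suffices that
    b + L <= (1 + 4 L + 8 sqrt L) / c. For c = 52 and b = 1/52 this reads 6 L <= sqrt L; for c = 4
    and b = 7/12 it reads sqrt L >= 1/6. The two ranges meet at L = 1/36. *)
Lemma bex_pen_excess {R : realType} {I : finType} (p : I -> R) (m : {set {set I}})
    (rho L : R) :
  finset.partition m [set: I] -> 0 < rho -> (forall i, rho <= p i <= 1 - rho) ->
  (forall J, J \in m -> 9000 <= #|J|%:R * rho ^+ 2) -> 0 < L ->
  bex p (fun Y => pen_excess L #|m|%:R (\sum_(J in m) Zdev p J Y)) <=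
    52 * expR (- (L * #|m|%:R)).
Proof.
move=> hm rho0 hp hJ L0; set D : R := #|m|%:R.
have D0 : 0 <= D by [].
have p01 i : 0 <= p i <= 1 by have := hp i; lra.
have a01 J : J \in m -> 0 < savg J p < 1.
  by move=> Jm; have := savg_itv J p _ _ (partition_card_gt0 _ _ hm Jm) hp; lra.
have s0 := sqrtr_ge0 L; have s2 := sqr_sqrtr (ltW L0).
rewrite /pen_excess; set pn := D * _.
have key (c b : R) : 0 < c -> c <= 52 ->
   (forall J, J \in m -> bex p (fun Y => expR (Zdev p J Y * c^-1)) <= expR b) ->
   b + L <= (1 + 4 * L + 8 * Num.sqrt L) / c ->
   bex p (fun Y => c * expR ((\sum_(J in m) Zdev p J Y - pn) / c)) <= 52 * expR (- (L * D)).
  move=> c0 c52 hb hL.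
  have -> : bex p (fun Y => c * expR ((\sum_(J in m) Zdev p J Y - pn) / c)) =
     bex p (fun Y => (c * expR (- (pn / c))) * expR ((\sum_(J in m) Zdev p J Y) * c^-1)).
    by apply: eq_bex => Y; rewrite -mulrA -expRD mulrBl addrC.
  rewrite bexZ -mulrA; apply: ler_pM => //; first exact: ltW.
    rewrite mulr_ge0 ?expR_ge0 //; apply: sumr_ge0 => Y _.
    by rewrite mulr_ge0 ?bweight_ge0 // expR_ge0.
  apply: (@le_trans _ _ (expR (- (pn / c)) * expR (b *+ #|m|))).
    by rewrite ler_wpM2l ?expR_ge0 // bex_sum_Zdev.
  rewrite -expRD ler_expR -mulr_natr -/D /pn.
  have := ler_wpM2r D0 hL; lra.
case: ifP => hL.
  apply: (key 52 52^-1) => //; first by move=> J Jm;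
    apply: (@bex_Zdev_small _ _ _ _ rho) => //; [exact: partition_card_gt0 Jm | exact: hJ].
  have : 6 * L <= Num.sqrt L; last by lra.
  have : Num.sqrt L <= 6^-1; last by nra.
  rewrite -(@ler_pXn2r _ 2) ?nnegrE // s2; lra.
apply: (key 4 (7 / 12)) => //; first by rewrite ler_nat.
- by move=> J Jm; apply: le_trans expR_7_12; apply: bex_Zdev_quarter => //;
    [exact: partition_card_gt0 Jm | exact: a01].
- have : 6^-1 <= Num.sqrt L; last by lra.
  by rewrite -(@ler_pXn2r _ 2) ?nnegrE // s2; move/negbT: hL; rewrite -ltNge; lra.
Qed.

(** * Likelihood ratios, the selection inequality and the risk bound *)

Definition llr {R : realType} (p r : R) (b : bool) : R :=
  if b then ln (r / p) else ln ((1 - r) / (1 - p)).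

(* The Hellinger affinity is 1 - hd/2 <= exp (- hd/2). *)
Lemma bex_llr {R : realType} {I : finType} (p r : I -> R) :
  (forall i, 0 < p i < 1) -> (forall i, 0 < r i < 1) ->
  bex p (fun Y => expR ((\sum_i (llr (p i) (r i) (Y i) + hd (p i) (r i))) / 2)) <= 1.
Proof.
move=> hp hr.
have -> : bex p (fun Y => expR ((\sum_i (llr (p i) (r i) (Y i) + hd (p i) (r i))) / 2)) =
  bex p (fun Y => \prod_i (fun i b => expR ((llr (p i) (r i) b + hd (p i) (r i)) / 2)) i (Y i)).
  by apply: eq_bex => Y; rewrite mulr_suml expR_sum.
rewrite (bex_prod p (fun i b => expR ((llr (p i) (r i) b + hd (p i) (r i)) / 2))).
apply: prodr_ile1 => i _; have /andP[p0 p1] := hp i; have /andP[r0 r1] := hr i.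
have aux (x y : R) : 0 < x -> 0 < y -> x * expR (ln (y / x) / 2) = Num.sqrt x * Num.sqrt y.
  move=> x0 y0; have -> : ln (y / x) / 2 = ln (Num.sqrt (y / x)).
    have s0 : 0 < Num.sqrt (y / x) by rewrite sqrtr_gt0 divr_gt0.
    rewrite -[in LHS](@sqr_sqrtr _ (y / x)) ?ltW ?divr_gt0 // lnXn // -[ln _ *+ 2]mulr_natr.
    by rewrite mulfK.
  rewrite lnK ?posrE ?sqrtr_gt0 ?divr_gt0 // sqrtrM ?ltW // sqrtrV ?ltW //.
  rewrite -{1}(sqr_sqrtr (ltW x0)); field.
  by rewrite gt_eqF // sqrtr_gt0.
have hb b : expR ((llr (p i) (r i) b + hd (p i) (r i)) / 2) =
    expR (llr (p i) (r i) b / 2) * expR (hd (p i) (r i) / 2) by rewrite mulrDl expRD.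
have p1' : 0 < 1 - p i by rewrite subr_gt0.
have r1' : 0 < 1 - r i by rewrite subr_gt0.
rewrite !hb !mulrA /llr (aux (p i) (r i)) // (aux (1 - p i) (1 - r i)) // -mulrDl.
apply/andP; split.
  by rewrite mulr_ge0 ?expR_ge0 // addr_ge0 // mulr_ge0 // sqrtr_ge0.
have -> : Num.sqrt (p i) * Num.sqrt (r i) + Num.sqrt (1 - p i) * Num.sqrt (1 - r i) =
    1 - hd (p i) (r i) / 2.
  by rewrite hdE ?(ltW p0) ?(ltW p1) ?(ltW r0) ?(ltW r1) //; lra.
have h := expR_ge1Dx (- (hd (p i) (r i) / 2)).
apply: (@le_trans _ _ (expR (- (hd (p i) (r i) / 2)) * expR (hd (p i) (r i) / 2))).
  by rewrite ler_wpM2r ?expR_ge0.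
by rewrite -expRD addNr expR0.
Qed.

Lemma gamma_n_sub {R : realType} {n : nat} (f0 f : 'I_n -> R) (Y : {ffun 'I_n -> bool}) :
  gamma_n Y f - gamma_n Y f0 = n%:R^-1 * \sum_i (- llr (pi_ f0 i) (pi_ f i) (Y i)).
Proof.
rewrite /gamma_n -mulrBr -sumrB; congr (_ * _); apply: eq_bigr => i _.
have /andP[? ?] := pi_itv f0 i; have /andP[? ?] := pi_itv f i.
rewrite /llr /bit; case: (Y i); rewrite ln_div ?posrE ?subr_gt0 ?ln_pi ?ln_one_sub_pi //; ring.
Qed.

Lemma bex_gamma_n_sub {R : realType} {n : nat} (f0 f : 'I_n -> R) :
  bex (pi_ f0) (fun Y => gamma_n Y f - gamma_n Y f0) = KL f0 f.
Proof.
have -> : bex (pi_ f0) (fun Y => gamma_n Y f - gamma_n Y f0) =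
    bex (pi_ f0) (fun Y => n%:R^-1 * \sum_i (- llr (pi_ f0 i) (pi_ f i) (Y i))).
  by apply: eq_bex => Y; exact: gamma_n_sub.
rewrite bexZ bex_sum; congr (_ * _); apply: eq_bigr => i _.
rewrite (bex_coord _ _ (fun b => - llr (pi_ f0 i) (pi_ f i) b)) /llr.
move: (pi_ f0 i) (pi_ f i) (pi_itv f0 i) (pi_itv f i) => a b /andP[? ?] /andP[? ?].
by rewrite !ln_div ?posrE ?subr_gt0 //; ring.
Qed.

Lemma hell2_le1 {R : realType} {n : nat} (p q : 'I_n -> R) :
  (forall i, 0 <= p i <= 1) -> (forall i, 0 <= q i <= 1) -> hell2 p q <= 1.
Proof.
move=> hp hq; rewrite /hell2.
have h : \sum_(i < n) hd (p i) (q i) <= 2 * n%:R.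
  have -> : 2 * n%:R = \sum_(i < n) (2 : R) by rewrite sumr_const card_ord mulr_natr.
  by apply: ler_sum => i _; exact: hd_le2.
have [n0|n0] := posnP n; first by rewrite [in X in X^-1]n0 mulr0 invr0 mul0r.
by rewrite ler_pdivrMl ?mulr1 // mulr_gt0 // ltr0n.
Qed.

Lemma KL_ge0 {R : realType} {n : nat} (f0 f : 'I_n -> R) : 0 <= KL f0 f.
Proof.
rewrite mulr_ge0 ?invr_ge0 // sumr_ge0 // => i _; apply: kl_ge0; last exact: pi_itv.
by case/andP: (pi_itv f0 i) => ? ?; rewrite !ltW.
Qed.

(** A nonempty union of blocks of [mf] contains one of them. *)
Lemma refines_card {R : realType} {n : nat} (mf m : {set {set 'I_n}}) (b : R) :
  finset.partition m [set: 'I_n] -> refines mf m ->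
  (forall J, J \in mf -> b <= #|J|%:R) -> forall J, J \in m -> b <= #|J|%:R.
Proof.
move=> hm hr hb J Jm; have [A [Amf JE]] := hr J Jm.
have /card_gt0P[i iJ] := partition_card_gt0 m J hm Jm.
move: (iJ); rewrite JE => /finset.bigcupP[K KA iK].
apply: (le_trans (hb K (fintype.subsetP Amf K KA))); rewrite ler_nat.
by apply: subset_leq_card; apply: finset.bigcup_sup.
Qed.

(* The basic inequality gamma_n (hat f_m') + pen m' <= gamma_n (fbar_m) + pen m, rewritten with
   the log-likelihood ratio and the Kullback divergence between block averages; c is 2 C_mu. *)
Lemma hell2_le_selected {R : realType} {n : nat} (f0 f : 'I_n -> R) (Y : {ffun 'I_n -> bool})
    (m : {set {set 'I_n}}) (g : R) (qh : 'I_n -> R) (penm pen' c : R)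
    (r := bavg m (pi_ f0)) :
  (0 < n)%N -> finset.partition m [set: 'I_n] -> is_mce m Y g qh ->
  (forall i, 0 < r i < 1) -> 1 < c ->
  g + penm <= gamma_n Y f + pen' ->
  hell2 (pi_ f0) qh <= c / 2 * (gamma_n Y f - gamma_n Y f0 + pen'
    + n%:R^-1 * (\sum_i (llr (pi_ f0 i) (r i) (Y i) + hd (pi_ f0 i) (r i))
      + c / (c - 1) * (\sum_(J in m) Zdev (pi_ f0) J Y)) - penm).
Proof.
move=> n0 hm hmce r01 c1 hle.
have c0 : 0 < c by lra.
have c10 : 0 < c - 1 by lra.
have [gE qE] := mceE m Y g qh n0 hm hmce.
have n0' : 0 < n%:R :> R by rewrite ltr0n.
have p01 i : 0 <= pi_ f0 i <= 1 by case/andP: (pi_itv f0 i) => ? ?; rewrite !ltW.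
pose q := bavg m (fun i => bit R (Y i)).
have q01 i : 0 <= q i <= 1 by apply: bavg01 => j; exact: bit01.
have ZE : \sum_(J in m) Zdev (pi_ f0) J Y = \sum_i kl (q i) (r i).
  by rewrite -(@sum_pblock _ _ m (fun J => kl (savg J (fun i => bit R (Y i))) (savg J (pi_ f0)))).
have gbar := gamma_n_sub f0 (logit r) Y.
have := gamma_nE m Y (logit r) hm (logit_bavg_S _ _ hm); rewrite -/q => gbar2.
have piE i : pi_ (logit r) i = r i by rewrite pi_logit.
have KE : \sum_i kl (q i) (pi_ (logit r) i) = \sum_i kl (q i) (r i).
  by apply: eq_bigr => i _; rewrite piE.
have LE : \sum_i (- llr (pi_ f0 i) (pi_ (logit r) i) (Y i)) =
    - \sum_i llr (pi_ f0 i) (r i) (Y i).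
  by rewrite -sumrN; apply: eq_bigr => i _; rewrite piE.
rewrite KE in gbar2; rewrite LE in gbar.
rewrite ZE big_split /=.
(* Triangle inequality with the conjugate pair c and c / (c - 1), then [hd] <= [kl] for the
   estimation part. *)
have hell : hell2 (pi_ f0) qh <= (2 * n%:R)^-1 *
    (c * (\sum_i hd (pi_ f0 i) (r i)) + c / (c - 1) * (\sum_i kl (q i) (r i))).
  rewrite /hell2 ler_wpM2l ?invr_ge0 ?mulr_ge0 // !mulr_sumr -big_split /=.
  apply: ler_sum => i _; rewrite qE -/q.
  apply: (@le_trans _ _ (c * hd (pi_ f0 i) (r i) + c / (c - 1) * hd (r i) (q i))).
    apply: hd_triangle => //; first exact: divr_gt0.
    by rewrite invf_div; field; rewrite gt_eqF.
  rewrite lerD2l ler_wpM2l //; last exact: kl_ge_hd.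
  by rewrite divr_ge0 // ltW.
move: gE gbar gbar2 hell hle; rewrite -/q invfM.
move: (\sum_i ent _) (\sum_i kl _ _) (\sum_i llr _ _ _) (\sum_i hd _ _) => e K L H.
move: (gamma_n Y f) (gamma_n Y f0) (gamma_n Y (logit r)) (hell2 _ _) (n%:R^-1 : R)
  => gf g0 gr h w gE gbar gbar2 hell hle.
apply: (le_trans hell).
(* The selection inequality with the estimator eliminated by g = gamma_n(f_0) - w L - w K. Times c /
   2 it is exactly the gap to fill, as c / (c - 1) - 1 / (c - 1) = 1. *)
have hX : 0 <= gf - g0 + pen' + w * L + w * K - penm by lra.
rewrite -subr_ge0 [leRHS](_ : _ = c / 2 * (gf - g0 + pen' + w * L + w * K - penm)).
  by rewrite mulr_ge0 // divr_ge0 // ltW.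
by field; rewrite gt_eqF.
Qed.

(** The penalty absorbs the deviations, with k = mu^(1/3). The coefficient 4 k / (3 k + 1) is c / (c
    - 1) at c = 2 C_mu and is at most k; then k (1 + 4 L + 8 s) + 2 L <= k (1 + 6 L + 8 s), and k <=
    k^3. *)
Lemma excess_le {R : realType} (k D L s w K A X1 X2 pn : R) :
  1 < k -> 0 <= D -> 0 < L -> 0 <= s -> 0 <= w -> 0 <= K ->
  K <= D * (1 + 4 * L + 8 * s) + X1 -> A <= 2 * (L * D) + X2 ->
  k ^+ 3 * (D * w) * (1 + 6 * L + 8 * s) <= pn ->
  w * (A + 4 * k / (3 * k + 1) * K) - pn <= w * (k * X1 + X2).
Proof.
move=> k1 D0 L0 s0 w0 K0 hK hA hpn.
have k0 : 0 < k by lra.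
have LD0 : 0 <= L * D by rewrite mulr_ge0 // ltW.
have sD0 : 0 <= s * D by rewrite mulr_ge0.
have tK : 4 * k / (3 * k + 1) * K <= k * K.
  by rewrite ler_wpM2r // ler_pdivrMr; [nra | lra].
have kK : k * K <= k * (D * (1 + 4 * L + 8 * s) + X1) by rewrite ler_pM2l.
have kk : k <= k ^+ 3 by rewrite ler_eXnr // ltW.
have hk : k * (D + 6 * (L * D) + 8 * (s * D)) <= k ^+ 3 * (D + 6 * (L * D) + 8 * (s * D)).
  by rewrite ler_wpM2r //; lra.
have kLD : L * D <= k * (L * D) by rewrite ler_peMl // ltW.
have h : w * (A + 4 * k / (3 * k + 1) * K) <=
    w * (k ^+ 3 * (D + 6 * (L * D) + 8 * (s * D)) + (k * X1 + X2)).
  by rewrite ler_wpM2l //; lra.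
by lra.
Qed.

Lemma itv_open {R : realType} (rho a : R) : 0 < rho -> rho <= a <= 1 - rho -> 0 < a < 1.
Proof. by move=> rho0 /andP[? ?]; apply/andP; split; lra. Qed.

Lemma mul_sqr_ln_ge {R : realType} (c b x : R) : 0 < c -> 0 <= b ->
  expR (Num.sqrt (b / c)) <= x -> b <= c * ln x ^+ 2.
Proof.
move=> c0 b0 hx; have x0 : 0 < x by apply: lt_le_trans hx; exact: expR_gt0.
have h : Num.sqrt (b / c) <= ln x by rewrite -ler_expR lnK ?posrE.
rewrite -ler_pdivrMl // mulrC -[leLHS]sqr_sqrtr; last by rewrite divr_ge0 // ltW.
by apply: lerXn2r; rewrite ?nnegrE ?sqrtr_ge0 // (le_trans (sqrtr_ge0 _) h).
Qed.

Theorem theorem4p1 (R : realType) (rho mu Gamma : R) :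
  0 < rho -> 1 < mu -> 0 < Gamma ->
  exists C : R -> R,
  forall (n : nat) (f0 : 'I_n -> R)
    (mf : {set {set 'I_n}}) (M : {set {set {set 'I_n}}})
    (L pen : {set {set 'I_n}} -> R)
    (fm : {set {set 'I_n}} -> 'I_n -> R)
    (ghat : {set {set 'I_n}} -> {ffun 'I_n -> bool} -> R)
    (qhat : {set {set 'I_n}} -> {ffun 'I_n -> bool} -> 'I_n -> R)
    (mhat : {ffun 'I_n -> bool} -> {set {set 'I_n}}),
  (forall i, rho <= pi_ f0 i) ->
  (forall i, rho <= 1 - pi_ f0 i) ->
  interval_partition mf ->
  (forall J, J \in mf -> Gamma * (ln (n%:R : R)) ^+ 2 <= #|J|%:R) ->
  (forall m, m \in M -> interval_partition m) ->
  (forall m, m \in M -> refines mf m) ->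
  (forall m, m \in M -> S_ m (fm m) /\
     (forall f, S_ m f -> KL f0 (fm m) <= KL f0 f)) ->
  (forall m Y, m \in M -> is_mce m Y (ghat m Y) (qhat m Y)) ->
  (forall m, m \in M -> 0 < L m) ->
  (forall m, m \in M -> 0 <= pen m) ->
  (forall m, m \in M ->
     mu * (#|m|%:R / n%:R) * (1 + 6 * L m + 8 * Num.sqrt (L m)) <= pen m) ->
  (forall Y, mhat Y \in M /\
     (forall m, m \in M -> ghat (mhat Y) Y + pen (mhat Y) <= ghat m Y + pen m)) ->
  let Sigma := \sum_(m in M) expR (- (L m * #|m|%:R)) in
  let Cmu := 2 * mu `^ (3^-1) / (mu `^ (3^-1) - 1) in
  forall m, m \in M ->
    Expect f0 (fun Y => hell2 (pi_ f0) (qhat (mhat Y) Y))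
      <= Cmu * (KL f0 (fm m) + pen m) + C Sigma / n%:R.
Proof.
move=> rho0 mu1 Gamma0.
pose k : R := mu `^ (3^-1); pose Cm : R := 2 * k / (k - 1).
have k3 : k ^+ 3 = mu.
  by rewrite /k -powR_mulrn ?powR_ge0 // -powRrM mulVf // powRr1 // ltW // (lt_trans ltr01).
have k1 : 1 < k.
  rewrite ltNge; apply/negP => k1; have : k ^+ 3 <= 1 by rewrite exprn_ile1 ?powR_ge0.
  by rewrite k3 leNgt mu1.
have k10 : 0 < k - 1 by rewrite subr_gt0.
have k0 : 0 <= k by rewrite powR_ge0.
have w52 : 0 <= 52 * k + 2 by rewrite addr_ge0 // mulr_ge0.
have c1 : 1 < 2 * (2 * k / (k - 1)) by rewrite mulrA ltr_pdivlMr //; lra.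
have tauE : 2 * (2 * k / (k - 1)) / (2 * (2 * k / (k - 1)) - 1) = 4 * k / (3 * k + 1).
  by field; rewrite !gt_eqF //; lra.
have Cm0 : 0 < Cm by rewrite divr_gt0 // mulr_gt0 // (lt_trans ltr01).
have [b [b0 hb]] : exists b : R, 0 <= b /\ forall N, b <= N -> 9000 <= N * rho ^+ 2.
  exists (9000 / rho ^+ 2); split; first by rewrite divr_ge0 ?ler0n // exprn_ge0 // ltW.
  by move=> N; rewrite ler_pdivrMr // exprn_gt0.
pose n0 : R := expR (Num.sqrt (b / Gamma)).
(* [n0] covers the small n, where h^2 <= 1 <= n0 / n. For larger n each model costs exp (- L D)
   times 52 k for the Kullback term and 2 for the likelihood ratio, which adds up to a multiple of
   [Sigma]. *)
exists (fun S => n0 + Cm * (52 * k + 2) * S).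
move=> n f0 mf M L pen fm ghat qhat mhat hp1 hp2 [hmf _] hcard hM href hfm hmce hL hpen0 hpen
  hmhat Sigma Cmu m mM.
rewrite -/k -/Cm in Cmu *; rewrite /Cmu {Cmu}.
have S0 : 0 <= Sigma by apply: sumr_ge0 => *; exact: expR_ge0.
have hMp m' : m' \in M -> finset.partition m' [set: 'I_n] by move=> h; case: (hM _ h).
have p01 i : 0 <= pi_ f0 i <= 1 by case/andP: (pi_itv f0 i) => ? ?; rewrite !ltW.
have lead0 : 0 <= Cm * (KL f0 (fm m) + pen m).
  by rewrite mulr_ge0 ?(ltW Cm0) // addr_ge0 ?KL_ge0 // hpen0.
have rem0 : 0 <= Cm * (52 * k + 2) * Sigma.
  by rewrite mulr_ge0 // mulr_ge0 ?(ltW Cm0).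
rewrite -[Expect f0 _]/(bex (pi_ f0) (fun Y => hell2 (pi_ f0) (qhat (mhat Y) Y))).
(* At n = 0 the inverse of n is 0 by convention, so the risk and the remainder both vanish. *)
have [n00|npos] := posnP n.
  rewrite [in X in _ / X]n00 invr0 mulr0 addr0; apply: le_trans lead0.
  rewrite [leRHS](_ : _ = bex (pi_ f0) (fun=> 0)); last by rewrite bex_cst.
  apply: bex_le => // Y; rewrite /hell2 [in X in X^-1]n00 mulr0 invr0 mul0r.
  exact: lexx.
have n0' : 0 < n%:R :> R by rewrite ltr0n.
have hq01 Y i : 0 <= qhat (mhat Y) Y i <= 1.
  have [mhM _] := hmhat Y.
  have [_ qE] := @mceE R n (mhat Y) Y (ghat (mhat Y) Y) (qhat (mhat Y) Y) npos
    (hMp (mhat Y) mhM) (hmce (mhat Y) Y mhM).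
  by rewrite (qE i); apply: bavg01 => j; exact: bit01.
have [nsmall|nlarge] := ltrP n%:R n0.
  apply: (@le_trans _ _ 1).
    by rewrite -(bex_cst (pi_ f0) 1); apply: bex_le => // Y; exact: hell2_le1.
  rewrite -[leLHS]add0r; apply: lerD => //.
  by rewrite ler_pdivlMr // mul1r (le_trans (ltW nsmall)) // lerDl.
have hbig m' : m' \in M -> forall J, J \in m' -> 9000 <= #|J|%:R * rho ^+ 2.
  move=> m'M J Jm; apply: hb.
  apply: (refines_card mf m') Jm; [exact: hMp | exact: href |].
  move=> K Kmf; apply: le_trans (hcard K Kmf).
  exact: mul_sqr_ln_ge.
have hpr i : rho <= pi_ f0 i <= 1 - rho by rewrite hp1 lerBrDr addrC -lerBrDr hp2.
pose r (m' : {set {set 'I_n}}) := bavg m' (pi_ f0).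
have r01 m' i : m' \in M -> 0 < r m' i < 1.
  move=> m'M; have [bm _] := pblock_in m' i (hMp _ m'M).
  by apply: (itv_open rho) => //; apply: savg_itv => //; apply: partition_card_gt0 bm; exact: hMp.
(* The competitor is the explicit Kullback projection on [m], compared with [fm m] at the end. *)
pose fb := logit (r m).
pose Zs (m' : {set {set 'I_n}}) (Y : {ffun 'I_n -> bool}) := \sum_(J in m') Zdev (pi_ f0) J Y.
pose As (m' : {set {set 'I_n}}) (Y : {ffun 'I_n -> bool}) :=
  \sum_i (llr (pi_ f0 i) (r m' i) (Y i) + hd (pi_ f0 i) (r m' i)).
pose X1 (m' : {set {set 'I_n}}) (Y : {ffun 'I_n -> bool}) := pen_excess (L m') #|m'|%:R (Zs m' Y).
(* This majorant comes from u <= exp u at u = A / 2 - L D. *)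
pose X2 (m' : {set {set 'I_n}}) (Y : {ffun 'I_n -> bool}) := 2 * expR (- (L m' * #|m'|%:R)) * expR (As m' Y / 2).
have X2E m' Y : As m' Y <= 2 * (L m' * #|m'|%:R) + X2 m' Y.
  rewrite /X2 -mulrA -expRD.
  by move: (L m' * _) (As m' Y) => u v; have := expR_ge1Dx (- u + v / 2); clear; lra.
have point Y : hell2 (pi_ f0) (qhat (mhat Y) Y) <=
    Cm * (pen m + (gamma_n Y fb - gamma_n Y f0)
      + n%:R^-1 * \sum_(m' in M) (k * X1 m' Y + X2 m' Y)).
  have [mhM mhmin] := hmhat Y; set m' := mhat Y in mhM mhmin *.
  have sel : ghat m' Y + pen m' <= gamma_n Y fb + pen m.
    apply: (le_trans (mhmin m mM)); rewrite lerD2r.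
    by have [h _] := hmce m Y mM; apply: h; apply: logit_bavg_S; exact: hMp.
  have := @hell2_le_selected _ _ f0 fb Y m' (ghat m' Y) (qhat m' Y) (pen m') (pen m) (2 * Cm)
    npos (hMp _ mhM) (hmce _ Y mhM) (fun i => r01 m' i mhM) c1 sel.
  rewrite [2 * Cm / 2]mulrAC divff // mul1r -/(As m' Y) -/(Zs m' Y).
  rewrite [2 * Cm / (2 * Cm - 1)]tauE.
  move=> /le_trans; apply; rewrite ler_pM2l // [pen m + _]addrC -addrA lerD2l.
  have Z0 : 0 <= Zs m' Y.
    apply: sumr_ge0 => J Jm; apply: Zdev_ge0.
    by apply: (itv_open rho) => //; apply: savg_itv => //; apply: partition_card_gt0 Jm; exact: hMp.
  have := hpen m' mhM; rewrite -k3 => hpm.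
  have w0 : 0 <= n%:R^-1 :> R by rewrite invr_ge0.
  apply: (le_trans (@excess_le _ k #|m'|%:R (L m') (Num.sqrt (L m')) n%:R^-1 (Zs m' Y) (As m' Y)
    (X1 m' Y) (X2 m' Y) (pen m') k1 (ler0n _ _) (hL _ mhM) (sqrtr_ge0 _) w0 Z0
    (le_pen_excess _ _ _) (X2E m' Y) hpm)).
  (* Union bound: the excess at the random selected model is at most the sum of the nonnegative
     excesses over all models. *)
  rewrite ler_wpM2l // (bigD1 m') //= lerDl; apply: sumr_ge0 => m2 _.
  apply: addr_ge0; first by rewrite mulr_ge0 ?pen_excess_ge0.
  by rewrite !mulr_ge0 // expR_ge0.
apply: (le_trans (bex_le _ _ _ p01 point)).
rewrite bexZ bexD (bexD _ (fun=> pen m)) bex_cst bex_gamma_n_sub.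
rewrite bexZ (bex_sum _ _ (fun m' Y => k * X1 m' Y + X2 m' Y)).
have hX : \sum_(m' in M) bex (pi_ f0) (fun Y => k * X1 m' Y + X2 m' Y) <= (52 * k + 2) * Sigma.
  rewrite mulr_sumr; apply: ler_sum => m' m'M.
  rewrite bexD (bexZ _ k (X1 m')) (bexZ _ _ (fun Y => expR (As m' Y / 2))).
  have h1 : k * bex (pi_ f0) (X1 m') <= k * (52 * expR (- (L m' * #|m'|%:R))).
    apply: (ler_wpM2l k0).
    exact: (@bex_pen_excess _ _ _ m' rho (L m') (hMp _ m'M) rho0 hpr (hbig _ m'M) (hL _ m'M)).
  have h2 := bex_llr (pi_ f0) (r m') (pi_itv f0) (fun i => r01 m' i m'M).
  rewrite [leRHS](_ : _ = k * (52 * expR (- (L m' * #|m'|%:R))) + 2 * expR (- (L m' * #|m'|%:R)));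
    last by ring.
  by apply: lerD => //; rewrite ler_piMr // mulr_ge0 // expR_ge0.
have hKL : KL f0 fb <= KL f0 (fm m).
  have [Sm _] := hfm m mM.
  by apply: KL_bavg_le => //; [exact: hMp | move=> i; exact: r01].
have hX' : n%:R^-1 * \sum_(m' in M) bex (pi_ f0) (fun Y => k * X1 m' Y + X2 m' Y) <=
    n%:R^-1 * ((52 * k + 2) * Sigma) by rewrite ler_wpM2l // invr_ge0.
apply: (@le_trans _ _ (Cm * (KL f0 (fm m) + pen m + n%:R^-1 * ((52 * k + 2) * Sigma)))).
  by rewrite ler_pM2l // lerD // [pen m + _]addrC lerD2r.
rewrite mulrDr lerD2l [leRHS]mulrC mulrCA ler_wpM2l ?invr_ge0 // mulrA lerDr.
exact: expR_ge0.
Qed.
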